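(* For every $p \in [1,\infty]$, every integer $m \geq 2$, and all positive constants $C_1, C_2$, there exists an open Riemannian manifold $(\mathcal{M}, g)$ of dimension $m$ on which the $L^p$-Calderón–Zygmund estimate with constants $C_1, C_2$ is invalid; more precisely, there is a smooth compactly supported function $f : \mathcal{M} \to \mathbb{R}$ such that $$\|\nabla\nabla f\|_{L^p}^p > C_1 \|\Delta f\|_{L^p}^p + C_2 \|f\|_{L^p}^p \quad \text{if } 1 \leq p < \infty,$$ and $$\|\nabla\nabla f\|_{L^\infty} > C_1 \|\Delta f\|_{L^\infty} + C_2 \|f\|_{L^\infty} \quad \text{if } p = \infty.$$
   Context: A Riemannian manifold (without boundary) $(\mathcal{M}, g)$ is called open if it is non-compact and geodesically complete. For a smooth function $f$ on $\mathcal{M}$, $\nabla\nabla f = \nabla_g \nabla_g f$ denotes the Hessian of $f$ (a 2-tensor field) with respect to the Levi-Civita connection of $g$, and $\Delta f = \Delta_g f$ denotes its trace under $g$, i.e. the Laplace–Beltrami operator applied to $f$. The norm $\|\cdot\|_{L^p}$ is the $L^p$-norm of functions or tensor fields on $\mathcal{M}$, taken with respect to the Riemannian volume measure of $g$ and the pointwise tensor norm induced by $g$. The $L^p$-Calderón–Zygmund estimate on $(\mathcal{M}, g)$ with constants $C_1, C_2$ is the assertion that $\|\nabla\nabla f\|_{L^p}^p \leq C_1\|\Delta f\|_{L^p}^p + C_2\|f\|_{L^p}^p$ for all $f \in C_c^\infty(\mathcal{M})$ (for $p=\infty$, the exponents $p$ on the norms are omitted). *)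

(* Defs.v *)
From HB Require Import structures.
From mathcomp Require Import all_boot all_order all_algebra.
From mathcomp Require Import all_classical all_reals all_analysis.

Set Implicit Arguments.
Unset Strict Implicit.
Unset Printing Implicit Defensive.
Import Order.TTheory GRing.Theory Num.Theory.
Import numFieldNormedType.Exports.

Local Open Scope classical_set_scope.
Local Open Scope ring_scope.

Section lebesgue_tuple.
Context {R : realType}.

Definition tuple_cons (n : nat) (x : measurableTypeR R * n.-tuple (measurableTypeR R)) :
  n.+1.-tuple (measurableTypeR R) := [tuple of x.1 :: x.2].

Lemma measurable_tuple_cons n : measurable_fun [set: _] (@tuple_cons n).
Proof. exact: measurable_cons. Qed.

HB.instance Definition _ n :=
  isMeasurableFun.Build _ _ _ _ (@tuple_cons n) (@measurable_tuple_cons n).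

Section step.
Variables (n : nat)
  (mu : {sigma_finite_measure set (n.-tuple (measurableTypeR R)) -> \bar R}).

Definition lebesgue_tuple_step : set (n.+1.-tuple (measurableTypeR R)) -> \bar R :=
  pushforward (@lebesgue_measure R \x mu)%E (@tuple_cons n).

HB.instance Definition _ := Measure.copy lebesgue_tuple_step
  (measure_function_pushforward__canonical__measure_function_Measure
     (@lebesgue_measure R \x mu)%E (@measurable_tuple_cons n)).

Let sigma_finite_step : sigma_finite setT lebesgue_tuple_step.
Proof.
have /sigma_finiteP[F [TF ndF Foo]] := sigma_finiteT (@lebesgue_measure R).
have /sigma_finiteP[G [TG ndG Goo]] := sigma_finiteT mu.
pose uncons (t : n.+1.-tuple (measurableTypeR R)) :
  measurableTypeR R * n.-tuple (measurableTypeR R) := (tnth t ord0, [tuple of behead t]).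
have munc : measurable_fun [set: _] uncons.
  apply: measurable_fun_pair; first exact: measurable_tnth.
  exact: measurable_behead.
exists (fun k => uncons @^-1` (F k `*` G k)).
  apply/esym; rewrite -subTset => t _.
  have [k _ Fk] : (\bigcup_k F k) (uncons t).1 by rewrite -TF.
  have [l _ Gl] : (\bigcup_k G k) (uncons t).2 by rewrite -TG.
  exists (maxn k l) => //; split.
    by move: Fk; exact/subsetPset/ndF/leq_maxl.
  by move: Gl; exact/subsetPset/ndG/leq_maxr.
move=> k; have [mF Fk] := Foo k; have [mG Gk] := Goo k; split.
  by rewrite -[_ @^-1` _]setTI; apply: munc => //; exact: measurableX.
rewrite /lebesgue_tuple_step /pushforward -comp_preimage.
rewrite (_ : uncons \o _ = id) ?preimage_id; last first.
  by apply/funext => -[x t] /=; congr pair; apply: val_inj.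
by rewrite product_measure1E// lte_mul_pinfty// ge0_fin_numE.
Qed.

HB.instance Definition _ := Measure_isSigmaFinite.Build _ _ _
  lebesgue_tuple_step sigma_finite_step.

End step.

Fixpoint lebesgue_tuple (n : nat) :
    {sigma_finite_measure set (n.-tuple (measurableTypeR R)) -> \bar R} :=
  match n with
  | 0 => @dirac _ _ [tuple] R
  | n'.+1 => lebesgue_tuple_step (lebesgue_tuple n')
  end.

End lebesgue_tuple.

Section smooth_functions.
Context {R : realType} {m : nat}.
Implicit Types (U : set 'rV[R]_m) (f : 'rV[R]_m -> R).

Definition partial (i : 'I_m) f : 'rV[R]_m -> R :=
  fun x => 'D_(delta_mx ord0 i) f x.

(* U is meant to be open; the values of f outside U are irrelevant. *)
Fixpoint Ck_on (k : nat) U f : Prop :=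
  (forall x, U x -> {for x, continuous f}) /\
  match k with
  | 0 => True
  | k'.+1 => forall i, (forall x, U x -> derivable f x (delta_mx ord0 i)) /\
                       Ck_on k' U (partial i f)
  end.

Definition smooth_on U f : Prop := forall k, Ck_on k U f.

End smooth_functions.

(* A chart of T onto an open subset of R^m; the functions are total, and only
   the values of chart_map on chart_dom and of chart_inv on its image matter. *)
Record chart (R : realType) (m : nat) (T : topologicalType) := Chart {
  chart_dom : set T;
  chart_map : T -> 'rV[R]_m;
  chart_inv : 'rV[R]_m -> T;
  chart_dom_open : open chart_dom;
  chart_image_open : open (chart_map @` chart_dom);
  chart_mapK : forall q, chart_dom q -> chart_inv (chart_map q) = q;
  chart_map_continuous : forall q, chart_dom q -> {for q, continuous chart_map};
  chart_inv_continuous :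
    forall x, (chart_map @` chart_dom) x -> {for x, continuous chart_inv}
}.

Definition transition (R : realType) (m : nat) (T : topologicalType)
    (c d : chart R m T) : 'rV[R]_m -> 'rV[R]_m :=
  fun x => chart_map d (chart_inv c x).

Definition overlap (R : realType) (m : nat) (T : topologicalType)
    (c d : chart R m T) : set 'rV[R]_m :=
  chart_map c @` (chart_dom c `&` chart_dom d).

(* Entry (a, b) is the partial derivative in x_a of the b-th new coordinate. *)
Definition transition_jacobian (R : realType) (m : nat) (T : topologicalType)
    (c d : chart R m T) (x : 'rV[R]_m) : 'M[R]_m :=
  \matrix_(a < m, b < m) partial a (fun y => transition c d y ord0 b) x.

(* A smooth m-manifold without boundary, given by a smooth atlas
   (mf_chart i)_i; mf_at q is the index of some chart around q. *)
Record manifold (R : realType) (m : nat) := Manifold {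
  mf_space :> ptopologicalType;
  mf_hausdorff : hausdorff_space mf_space;
  mf_second_countable : @second_countable mf_space;
  mf_index : Type;
  mf_chart : mf_index -> chart R m mf_space;
  mf_at : mf_space -> mf_index;
  mf_atP : forall q, chart_dom (mf_chart (mf_at q)) q;
  mf_smooth : forall i j b,
    smooth_on (overlap (mf_chart i) (mf_chart j))
      (fun x => transition (mf_chart i) (mf_chart j) x ord0 b)
}.

Definition chart_image (R : realType) (m : nat) (M : manifold R m)
  (i : mf_index M) : set 'rV[R]_m :=
  chart_map (mf_chart i) @` chart_dom (mf_chart i).

(* rm_metric i x is the matrix of the components g_ab of the metric in the
   i-th chart, at the point of coordinates x; rm_metric_change is the
   transformation law of a (0,2)-tensor. *)
Record riemannian_manifold (R : realType) (m : nat) := RiemannianManifold {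
  rm_manifold :> manifold R m;
  rm_metric : mf_index rm_manifold -> 'rV[R]_m -> 'M[R]_m;
  rm_metric_smooth : forall i a b,
    smooth_on (chart_image i) (fun x => rm_metric i x a b);
  rm_metric_sym : forall i x, chart_image i x ->
    (rm_metric i x)^T = rm_metric i x;
  rm_metric_pos : forall i x, chart_image i x ->
    forall v : 'rV[R]_m, v != 0 -> 0 < (v *m rm_metric i x *m v^T) ord0 ord0;
  rm_metric_change : forall i j x, overlap (mf_chart i) (mf_chart j) x ->
    let J := transition_jacobian (mf_chart i) (mf_chart j) x in
    rm_metric i x
      = J *m rm_metric j (transition (mf_chart i) (mf_chart j) x) *m J^T
}.

Section riemannian_geometry.
Context {R : realType} {m : nat} (M : riemannian_manifold R m).
Implicit Types (i : mf_index M) (x : 'rV[R]_m) (q : M) (f : M -> R).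

Definition coords i q : 'rV[R]_m := chart_map (mf_chart i) q.

Definition in_coords i f : 'rV[R]_m -> R := fun x => f (chart_inv (mf_chart i) x).

Definition smooth f : Prop := forall i, smooth_on (chart_image i) (in_coords i f).

Definition compactly_supported f : Prop := compact (closure [set q | f q != 0]).

Definition inv_metric i x : 'M[R]_m := invmx (rm_metric i x).

(* Christoffel symbols Gamma^k_ab of the Levi-Civita connection *)
Definition christoffel i (k a b : 'I_m) x : R :=
  2^-1 * \sum_(l < m) inv_metric i x k l *
    (partial a (fun y => rm_metric i y b l) x
     + partial b (fun y => rm_metric i y a l) x
     - partial l (fun y => rm_metric i y a b) x).

(* Components (nabla nabla f)_ab in the i-th chart *)
Definition hessian i f x : 'M[R]_m :=
  \matrix_(a < m, b < m)
    (partial a (partial b (in_coords i f)) x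
     - \sum_(k < m) christoffel i k a b x * partial k (in_coords i f) x).

(* The trace and the norm below do not depend on the chart used around q. *)
Definition laplacian f q : R :=
  let i := mf_at q in let x := coords i q in
  \sum_(a < m) \sum_(b < m) inv_metric i x a b * hessian i f x a b.

Definition hessian_norm f q : R :=
  let i := mf_at q in let x := coords i q in
  let G := inv_metric i x in let H := hessian i f x in
  Num.sqrt (\sum_(a < m) \sum_(b < m) \sum_(c < m) \sum_(d < m)
    G a c * G b d * H a b * H c d).

Definition curve_coord (c : R -> M) i (k : 'I_m) : R -> R :=
  fun t => coords i (c t) ord0 k.

Definition geodesic (c : R -> M) : Prop :=
  continuous c /\
  forall t i, chart_dom (mf_chart i) (c t) -> forall k : 'I_m,
    [/\ derivable (curve_coord c i k) t 1,
        derivable (derive1 (curve_coord c i k)) t 1 &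
        derive1 (derive1 (curve_coord c i k)) t
        + \sum_(a < m) \sum_(b < m) christoffel i k a b (coords i (c t))
            * derive1 (curve_coord c i a) t * derive1 (curve_coord c i b) t = 0].

(* For every point q and every tangent vector v at q, given by its components
   in the chart mf_at q, the geodesic with these initial data exists for all
   times. *)
Definition geodesically_complete : Prop :=
  forall q (v : 'rV[R]_m), exists c : R -> M,
    [/\ geodesic c, c 0 = q &
        forall k, derive1 (curve_coord c (mf_at q) k) 0 = v ord0 k].

Definition open_manifold : Prop :=
  ~ compact [set: M] /\ geodesically_complete.

Definition borel : measurableType (@open M).-sigma :=
  g_sigma_algebraType (@open M).

(* These conditions determine vol, since countably many chart domains cover M. *)
Definition riemannian_volume (vol : {measure set borel -> \bar R}) : Prop :=
  forall i (A : set borel), measurable A -> A `<=` chart_dom (mf_chart i) ->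
    let row_of (t : m.-tuple (measurableTypeR R)) : 'rV[R]_m :=
      \row_k tnth t k in
    vol A = (\int[lebesgue_tuple m]_(t in row_of @^-1` (coords i @` A))
               (Num.sqrt (\det (rm_metric i (row_of t))))%:E)%E.

End riemannian_geometry.

(* Main.v *)
Require Import Defs.
From mathcomp Require Import all_boot all_order all_algebra.
From mathcomp Require Import all_classical all_reals all_analysis.
From mathcomp Require Import ess_sup_inf ring lra.

Set Implicit Arguments.
Unset Strict Implicit.
Unset Printing Implicit Defensive.
Import Order.TTheory GRing.Theory Num.Theory.
Import numFieldNormedType.Exports.

Local Open Scope classical_set_scope.
Local Open Scope ring_scope.

(** Multiplying a metric by a constant mu multiplies the norm of the Hessian
    and the Laplacian of a function by 1/mu, leaves the function alone, and
    multiplies the volume by a constant. A small mu therefore makes the term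
    with C2 negligible, and it is enough to find one complete non-compact
    metric on which no inequality |Hess f|_p <= C |Delta f|_p holds.

    Such a metric on R^m is
      cosh^2(x_0) dx_0^2 + cosh^-2(x_0) dx_1^2 + dx_2^2 + ... + dx_(m-1)^2,
    that is, dr^2 + dy^2 / (1 + r^2) times a flat factor, for r = sinh x_0.
    For a function F of x_0 alone,
      Delta F = cosh^-2 (F'' - 2 tanh F'),
      Hess F (e_1, e_1) = - tanh cosh^-2 F',
    where e_1 is the unit vector along x_1 ([laplacianE], [hessian_norm_ge]).
    Hence F = exp(2 x_0) becomes harmonic as x_0 grows, since tanh tends to 1,
    while its Hessian stays bounded below. In these coordinates the volume is a
    multiple of Lebesgue measure, so cutting F off over an interval of length N
    costs only O(1/N) in the Laplacian ([laplacian_small]) and leaves a Hessian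
    of order 1 on a fixed proportion of the support ([hessian_large]). The
    cut-offs in the other coordinates, over a length L, contribute O(L^-2) with
    a constant that depends on N, and L is chosen after N. These bounds are
    pointwise, so that they refute the estimate for all exponents at once, also
    for 1 and infinity ([Lnorm_estimate_fails]).

    The metric is complete because its geodesics are elementary: along a
    geodesic, c = x_1' / cosh^2(x_0) is constant and r = sinh x_0 satisfies the
    oscillator equation r'' = - c^2 r ([warped_complete]). *)

(** * Smooth functions of one real variable *)

Section smooth1.
Context {R : realType}.
Implicit Types (f g h : R -> R) (x a b : R) (k n : nat).

(** The derivative is a witness rather than derive1 f, so that the closure
    properties below only have to exhibit its formula. *)
Fixpoint kdiff k f : Prop :=
  if k is k'.+1 then
    exists g, (forall x, is_derive x 1 f (g x)) /\ kdiff k' g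
  else True.

Definition smooth1 f : Prop := forall k, kdiff k f.

Lemma kdiffW k f : kdiff k.+1 f -> kdiff k f.
Proof.
elim: k f => [//|k IH] f [g [fg kg]].
by exists g; split => //; exact: IH.
Qed.

Lemma kdiffD k f g : kdiff k f -> kdiff k g -> kdiff k (fun x => f x + g x).
Proof.
elim: k f g => [//|k IH] f g [f1 [ff1 kf1]] [g1 [gg1 kg1]].
exists (fun x => f1 x + g1 x); split; last exact: IH.
by move=> x; exact: is_deriveD.
Qed.

Lemma kdiffM k f g : kdiff k f -> kdiff k g -> kdiff k (fun x => f x * g x).
Proof.
elim: k f g => [//|k IH] f g kf kg.
move: (kf) (kg) => [f1 [ff1 kf1]] [g1 [gg1 kg1]].
exists (fun x => f x * g1 x + g x * f1 x); split.
  by move=> x; exact: is_deriveM.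
by apply: kdiffD; apply: IH => //; exact: kdiffW.
Qed.

Lemma kdiff_cst k a : kdiff k (fun=> a).
Proof.
elim: k a => [//|k IH] a; exists (fun=> 0); split => // x.
exact: is_derive_cst.
Qed.

Lemma is_derive_affine f a b x df : is_derive (a * x + b) 1 f df ->
  is_derive x 1 (fun y => f (a * y + b)) (df * a).
Proof.
move=> fdf; apply: (@is_derive1_comp R f (fun y => a * y + b)) => //.
have D1 : is_derive x 1 (fun y => a * y) (a *: 1) by exact: is_deriveZ.
apply: (is_derive_eq (is_deriveD D1 (is_derive_cst b x 1))).
by rewrite addr0 /GRing.scale /= mulr1.
Qed.

Lemma kdiff_affine k f a b : kdiff k f -> kdiff k (fun x => f (a * x + b)).
Proof.
elim: k f => [//|k IH] f [g [fg kg]].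
exists (fun x => g (a * x + b) * a); split.
  by move=> x; exact: is_derive_affine.
by apply: kdiffM; [exact: IH|exact: kdiff_cst].
Qed.

Lemma kdiffV k f : (forall x, f x != 0) -> kdiff k f -> kdiff k (fun x => (f x)^-1).
Proof.
move=> f0; elim: k => [//|k IH] kf; move: (kf) => [g [fg kg]].
exists (fun x => - 1 * (g x * ((f x)^-1 * (f x)^-1))); split.
  move=> x; apply: (is_derive_eq (is_deriveV (f0 x) (fg x))).
  by rewrite /GRing.scale /= -exprVn; ring.
have kV : kdiff k (fun x => (f x)^-1) by apply: IH; exact: kdiffW.
apply: kdiffM; first exact: kdiff_cst.
by apply: kdiffM => //; exact: kdiffM.
Qed.

Lemma smooth1_derive f n x :
  smooth1 f -> is_derive x 1 (derive1n n f) (derive1n n.+1 f x).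
Proof.
have H k h : kdiff k.+1 h -> kdiff k (derive1 h) /\ forall y : R, is_derive y 1 h (derive1 h y).
  move=> [g [hg kg]]; suff -> : derive1 h = g by [].
  by apply/funext => y; rewrite derive1E; case: (hg y).
elim: n f => [|n IH] f sf.
  by case: (H 1%N f (sf 2%N)) => _; exact.
rewrite [derive1n n.+2 f]derive1Sn derive1Sn; apply: IH => k.
by case: (H k f (sf k.+1)).
Qed.

Lemma derive1_eq f g : (forall x, is_derive x 1 f (g x)) -> derive1 f = g.
Proof. by move=> fg; apply/funext => x; rewrite derive1E; case: (fg x). Qed.

Lemma smooth1D f g : smooth1 f -> smooth1 g -> smooth1 (fun x => f x + g x).
Proof. by move=> sf sg k; exact: kdiffD. Qed.

Lemma smooth1M f g : smooth1 f -> smooth1 g -> smooth1 (fun x => f x * g x).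
Proof. by move=> sf sg k; exact: kdiffM. Qed.

Lemma smooth1V f : (forall x, f x != 0) -> smooth1 f -> smooth1 (fun x => (f x)^-1).
Proof. by move=> f0 sf k; exact: kdiffV. Qed.

Lemma smooth1_cst a : smooth1 (fun=> a).
Proof. by move=> k; exact: kdiff_cst. Qed.

Lemma smooth1_affine f a b : smooth1 f -> smooth1 (fun x => f (a * x + b)).
Proof. by move=> sf k; exact: kdiff_affine. Qed.

Lemma smooth1_id : smooth1 id.
Proof.
move=> [//|k]; exists (fun=> 1); split; last exact: kdiff_cst.
by move=> x; exact: is_derive_id.
Qed.

Lemma smooth1_expR : smooth1 expR.
Proof.
by elim=> [//|k IH]; exists expR; split => // x; exact: is_derive_expR.
Qed.

End smooth1.

(** * A compactly supported smooth bump *)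

Section bump.
Context {R : realType}.
Implicit Types (P Q : {poly R}) (x : R).

(** Extending P(1/x) exp(-1/x) by 0 for x <= 0 gives a class of functions that
    is stable under differentiation, whence the smoothness of exp(-1/x). *)
Definition flat P x : R :=
  if 0 < x then P.[x^-1] * expR (- x^-1) else 0.

Lemma powM_expRN_le n (y : R) : 0 < y -> y ^+ n * expR (- y) <= n.+1`!%:R * y^-1.
Proof.
move=> y0; have /(_ (ltW y0)) H := @expR_ge1Dxn _ y n.
have c0 : 0 < n.+1`!%:R :> R by rewrite ltr0n fact_gt0.
set c := n.+1`!%:R in c0 H *.
have E0 := expR_gt0 y.
have -> : y ^+ n * expR (- y) = y ^+ n.+1 / c * (c / y * expR (- y)).
  by rewrite exprS; field; rewrite !gt_eqF.
rewrite [leRHS](_ : _ = expR y * (c / y * expR (- y))); last first.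
  by rewrite expRN; field; rewrite !gt_eqF.
apply: ler_wpM2r; first by rewrite !mulr_ge0 ?expR_ge0 ?invr_ge0 ?ltW.
by apply: le_trans H; rewrite lerDr.
Qed.

(** The exponential beats the powers of 1/x, with a factor x to spare: it is
    this factor that makes [flat] continuous at 0. *)
Lemma flat_bound P : exists2 K, 0 <= K & forall x, `|flat P x| <= K * `|x|.
Proof.
exists (\sum_(i < size P) `|P`_i| * i.+1`!%:R).
  by apply: sumr_ge0 => i _; rewrite mulr_ge0.
move=> x; rewrite /flat; case: ifPn => [x0|_]; last first.
  by rewrite normr0 mulr_ge0// sumr_ge0// => i _; rewrite mulr_ge0.
rewrite horner_coef !mulr_suml; apply: le_trans (ler_norm_sum _ _ _) _.
apply: ler_sum => i _; rewrite 2!normrM -!mulrA ler_wpM2l//.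
rewrite [X in X * _]ger0_norm ?exprn_ge0 ?invr_ge0 ?(ltW x0)//.
rewrite [X in _ * X <= _]ger0_norm ?expR_ge0// (gtr0_norm x0).
by have := @powM_expRN_le i x^-1; rewrite invr_gt0 invrK; exact.
Qed.

Lemma flat_derive P x :
  is_derive x 1 (flat P) (flat ((P - P^`()) * 'X^2) x).
Proof.
have [x0|x0|->] := ltgtP x 0.
- rewrite {2}/flat lt_gtF//.
  apply: near_eq_is_derive (is_derive_cst 0 x 1).
  near=> y; rewrite /flat ifF//; apply/negbTE; rewrite -leNgt ltW//.
  by near: y; exact: lt_nbhsl.
- rewrite {2}/flat x0.
  have D : is_derive x 1 (fun y => P.[y^-1] * expR (- y^-1))
      (((P - P^`()) * 'X^2).[x^-1] * expR (- x^-1)).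
    have DV : is_derive x 1 (fun y : R => y^-1) (- x ^- 2).
      apply: (is_derive_eq (@is_deriveV R id x 1 1 _ (is_derive_id x 1))).
        by rewrite gt_eqF.
      by rewrite /GRing.scale /= mulr1.
    have D1 := @is_derive1_comp R (horner P) (fun y => y^-1) x _ _ (is_derive_poly P _) DV.
    have DN : is_derive x 1 (fun y : R => - y^-1) (- - x ^- 2) by apply: is_deriveN.
    have D2 := @is_derive1_comp R expR (fun y => - y^-1) x _ _ (is_derive_expR _) DN.
    apply: (is_derive_eq (is_deriveM D1 D2)).
    rewrite /GRing.scale /= !hornerE /= -exprVn.
    by ring.
  apply: near_eq_is_derive D.
  near=> y; rewrite /flat ifT//.
  by near: y; exact: lt_nbhsr.
- (* at 0, the slope of flat P is flat (P * 'X), which tends to 0 *)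
  apply/is_derive1_caratheodory; exists (flat (P * 'X)); split.
  + move=> z; rewrite /flat ltxx !subr0; case: ifP => z0; last by rewrite mul0r.
    by rewrite hornerM hornerX; field; rewrite gt_eqF.
  + have [K K0 HK] := flat_bound (P * 'X).
    have f0 : flat (P * 'X) 0 = 0 by rewrite /flat ltxx.
    change (flat (P * 'X) @ (0 : R) --> flat (P * 'X) 0); rewrite f0.
    have K1 : 0 < K + 1 by rewrite ltr_wpDl.
    apply/cvgr0Pnorm_le => e e0; near=> y.
    apply: le_trans (HK y) _.
    apply: (@le_trans _ _ ((K + 1) * `|y|)); first by rewrite ler_wpM2r// lerDl.
    rewrite -ler_pdivlMl//; near: y.
    have : (0 : R) < (K + 1)^-1 * e by rewrite mulr_gt0// invr_gt0.
    move=> d0; exists ((K + 1)^-1 * e) => //= z.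
    by rewrite /ball_ /= sub0r normrN => /ltW.
  + by rewrite /flat ltxx.
Unshelve. all: by end_near. Qed.

Lemma smooth1_flat P : smooth1 (flat P).
Proof.
move=> k; elim: k P => [//|k IH] P; exists (flat ((P - P^`()) * 'X^2)).
by split => // x; exact: flat_derive.
Qed.

Definition bump x : R := flat 1 (1 + x) * flat 1 (1 - x).

Lemma smooth1_bump : smooth1 bump.
Proof.
have -> : bump = (fun x => flat 1 (1 * x + 1) * flat 1 (- 1 * x + 1)).
  by apply/funext => x; rewrite /bump mul1r mulN1r [1 + x]addrC [1 - x]addrC.
by apply: smooth1M; apply: smooth1_affine; exact: smooth1_flat.
Qed.

Lemma bump_out x : 1 < `|x| -> bump x = 0.
Proof.
rewrite /bump /flat => x1; case: ifP => a; case: ifP => b; rewrite ?mulr0 ?mul0r//.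
by move: x1; rewrite ltNge ler_norml; move/negP; case; apply/andP; split; lra.
Qed.

Lemma flat1_itv x : 0 <= flat 1 x <= 1.
Proof.
rewrite /flat; case: ifP => x0; last by rewrite lexx ler01.
rewrite hornerC mul1r expR_ge0 /= expR_le1 oppr_le0 invr_ge0; exact: ltW.
Qed.

Lemma bump_ge0 x : 0 <= bump x.
Proof. by rewrite mulr_ge0//; case/andP: (flat1_itv (1 + x)); case/andP: (flat1_itv (1 - x)). Qed.

Lemma bump_le1 x : bump x <= 1.
Proof.
case/andP: (flat1_itv (1 + x)) => a b; case/andP: (flat1_itv (1 - x)) => c d.
by rewrite mulr_ile1.
Qed.

Definition bump_floor : R := expR (- 4).

Lemma bump_ge x : `|x| <= 2^-1 -> bump_floor <= bump x.
Proof.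
rewrite ler_norml => /andP[a b].
have flat_ge (z : R) : 2^-1 <= z -> expR (- 2) <= flat 1 z.
  move=> z2; have z0 : 0 < z by apply: lt_le_trans z2; rewrite invr_gt0.
  rewrite /flat z0 hornerC mul1r ler_expR lerN2.
  have -> : (2 : R) = (2^-1)^-1 by rewrite invrK.
  by rewrite lef_pV2// posrE invr_gt0.
have -> : bump_floor = expR (- 2) * expR (- 2).
  by rewrite -expRD; congr expR; lra.
by apply: ler_pM; rewrite ?expR_ge0//; apply: flat_ge; lra.
Qed.

Lemma bump_floor_gt0 : 0 < bump_floor. Proof. exact: expR_gt0. Qed.

Lemma derive1n_out (f : R -> R) a b n x :
  (forall y, 1 < `|a * y + b| -> f y = 0) ->
  1 < `|a * x + b| -> derive1n n f x = 0.
Proof.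
move=> f0; elim: n x => [|n IH] x x1; first exact: f0.
rewrite derive1nS derive1E (@near_eq_derive _ _ _ _ (cst 0)) ?derive_cst//.
near=> y; rewrite IH//; near: y.
have C : continuous (fun y : R => `|a * y + b|).
  move=> y; apply: (@continuous_comp _ _ _ (fun y => a * y + b) (@Num.norm R R)).
    by apply: cvgD; [apply: cvgM; [exact: cvg_cst|exact: cvg_id]|exact: cvg_cst].
  exact: norm_continuous.
by move/cvgr_gt: (C x); apply.
Unshelve. all: by end_near. Qed.

Lemma bump_derive_bound : exists2 A : R, 1 <= A &
  forall n x, (n <= 2)%N -> `|derive1n n bump x| <= A.
Proof.
have one n : exists A : R, forall x, `|derive1n n bump x| <= A.
  have cn : continuous (derive1n n bump).
    move=> x; apply: differentiable_continuous; apply/derivable1_diffP.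
    by case: (smooth1_derive n x smooth1_bump).
  have cw : {within `[-1, 1], continuous (fun x => `|derive1n n bump x|)}.
    apply: continuous_subspaceT => x.
    by apply: continuous_comp; [exact: cn|exact: norm_continuous].
  have N11 : (-1 : R) <= 1 by lra.
  have [c _ Hc] := EVT_max N11 cw.
  exists `|derive1n n bump c| => x; have [x1|x1] := leP `|x| 1.
    by apply: Hc; rewrite in_itv /= -ler_norml.
  rewrite (@derive1n_out _ 1 0) ?normr0 ?mul1r ?addr0// => y.
  by rewrite mul1r addr0; exact: bump_out.
have [A0 H0] := one 0%N; have [A1 H1] := one 1%N; have [A2 H2] := one 2%N.
exists (Num.max 1 (Num.max A0 (Num.max A1 A2))); first by rewrite le_max lexx.
case=> [|[|[|//]]] x _; rewrite !le_max.
- by rewrite H0 orbT.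
- by rewrite H1 !orbT.
- by rewrite H2 !orbT.
Qed.

End bump.

(** * Partial derivatives of products of functions of one coordinate *)

Section tensor.
Context {R : realType} {m : nat}.
Implicit Types (x v : 'rV[R]_m) (phi : 'I_m -> R -> R) (d : 'I_m -> nat) (i j : 'I_m).

Lemma is_derive_line (f : 'rV[R]_m -> R) x v (df : R) :
  is_derive (0 : R) (1 : R) (fun h : R => f (h *: v + x)) df -> is_derive x v f df.
Proof.
move=> [D <-].
have E : (fun h : R => h^-1 *: ((f \o shift x) (h *: v) - f x)) =
  (fun h : R => h^-1 *: (((fun h : R => f (h *: v + x)) \o shift 0) (h *: (1 : R)) - f (0 *: v + x))).
  apply/funext => h /=.
  by rewrite addr0 scale0r add0r /GRing.scale /= mulr1.
by split; rewrite /derivable /derive E.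
Qed.

(** Products of functions of one coordinate, the i-th one differentiated d i
    times. Partial derivatives only change d, so smoothness of these products
    follows by induction on the order. *)
Definition tensor phi d x : R := \prod_i derive1n (d i) (phi i) (x ord0 i).

Definition incr d j : 'I_m -> nat := fun i => (d i + (i == j))%N.

Lemma partial_eq j (f g : 'rV[R]_m -> R) :
  (forall x, is_derive x (delta_mx ord0 j) f (g x)) -> partial j f = g.
Proof. by move=> fg; apply/funext => x; rewrite /partial; case: (fg x). Qed.

Lemma is_derive_coord (f : R -> R) (df : R) i j x :
  is_derive (x ord0 i) 1 f df ->
  is_derive x (delta_mx ord0 j) (fun y => f (y ord0 i)) (df * (i == j)%:R).
Proof.
move=> fdf; apply: is_derive_line.
have -> : (fun h : R => f ((h *: delta_mx ord0 j + x) ord0 i)) =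
    (fun h : R => f ((i == j)%:R * h + x ord0 i)).
  by apply/funext => h; rewrite !mxE eqxx /= mulrC.
by apply: is_derive_affine; rewrite mulr0 add0r.
Qed.

Lemma is_derive_tensor phi d j x : (forall i, smooth1 (phi i)) ->
  is_derive x (delta_mx ord0 j) (tensor phi d) (tensor phi (incr d j) x).
Proof.
move=> sphi; apply: is_derive_line.
pose P := \prod_(i | i != j) derive1n (d i) (phi i) (x ord0 i).
have -> : (fun h : R => tensor phi d (h *: delta_mx ord0 j + x)) =
    (fun h : R => derive1n (d j) (phi j) (1 * h + x ord0 j) * P).
  apply/funext => h; rewrite /tensor (bigD1 j)//=; congr (_ * _).
    by rewrite !mxE !eqxx mulr1 mul1r.
  by apply: eq_bigr => i ij; rewrite !mxE (negbTE ij) andbF mulr0 add0r.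
have D : is_derive (0 : R) 1 (fun h : R => derive1n (d j) (phi j) (1 * h + x ord0 j))
    (derive1n (d j).+1 (phi j) (x ord0 j) * 1).
  by apply: is_derive_affine; rewrite mulr0 add0r; exact: smooth1_derive.
have D2 := is_deriveM D (is_derive_cst (P : R) (0 : R) (1 : R)).
suff -> : tensor phi (incr d j) x = derive1n (d j).+1 (phi j) (x ord0 j) * P.
  by apply: (is_derive_eq D2); rewrite scaler0 add0r /GRing.scale /= mulr1 mulrC.
rewrite /tensor (bigD1 j)//= /incr eqxx addn1; congr (_ * _).
by apply: eq_bigr => i /negbTE ->; rewrite addn0.
Qed.

Lemma partial_tensor phi d j : (forall i, smooth1 (phi i)) ->
  partial j (tensor phi d) = tensor phi (incr d j).
Proof. by move=> sphi; apply: partial_eq => x; exact: is_derive_tensor. Qed.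

Lemma continuous_tensor phi d : (forall i, smooth1 (phi i)) ->
  continuous (tensor phi d).
Proof.
move=> sphi; rewrite /tensor.
elim: (index_enum _) => [|i s IH] x.
  have -> : (fun x => \prod_(i <- [::]) derive1n (d i) (phi i) (x ord0 i)) = cst 1.
    by apply/funext => y; rewrite big_nil.
  exact: cst_continuous.
have -> : (fun x => \prod_(i <- i :: s) derive1n (d i) (phi i) (x ord0 i)) =
    (fun x => derive1n (d i) (phi i) (x ord0 i)
              * \prod_(i <- s) derive1n (d i) (phi i) (x ord0 i)).
  by apply/funext => y; rewrite big_cons.
have C : {for x, continuous (fun x : 'rV[R]_m => derive1n (d i) (phi i) (x ord0 i))}.
  apply: (@continuous_comp _ _ _ (fun x : 'rV[R]_m => x ord0 i) (derive1n (d i) (phi i))).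
    exact: coord_continuous.
  apply: differentiable_continuous; apply/derivable1_diffP.
  by case: (smooth1_derive (d i) (x ord0 i) (sphi i)).
exact: (continuousM C (IH x)).
Qed.

Lemma smooth_tensor phi d : (forall i, smooth1 (phi i)) ->
  smooth_on [set: 'rV[R]_m] (tensor phi d).
Proof.
move=> sphi k; elim: k d => [|k IH] d; split => //.
- by move=> x _; exact: continuous_tensor.
- by move=> x _; exact: continuous_tensor.
move=> i; split; last by rewrite partial_tensor.
by move=> x _; case: (is_derive_tensor d i x sphi).
Qed.

Lemma smooth_coord (f : R -> R) i : smooth1 f ->
  smooth_on [set: 'rV[R]_m] (fun x => f (x ord0 i)).
Proof.
move=> sf; (* all the other factors are 1 *)
pose phi j : R -> R := if j == i then f else fun=> 1.
have -> : (fun x : 'rV[R]_m => f (x ord0 i)) = tensor phi (fun=> 0%N).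
  apply/funext => x; rewrite /tensor (bigD1 i)//= /phi eqxx big1 ?mulr1//.
  by move=> j /negbTE ->.
apply: smooth_tensor => j; rewrite /phi; case: ifP => // _; exact: smooth1_cst.
Qed.

End tensor.

(** * Topology and Lebesgue measure of the coordinate space *)

Section boxes.
Context {R : realType} {m : nat}.
Implicit Types (x : 'rV[R]_m) (a b : 'I_m -> R).

Definition rat_box (q : {ffun 'I_m -> rat * rat}) : set 'rV[R]_m :=
  [set x | forall i, x ord0 i \in `](ratr (q i).1), (ratr (q i).2)[].

Lemma open_rat_box q : open (rat_box q).
Proof.
rewrite openE => x xq; exists (fun _ i => `](ratr (q i).1), (ratr (q i).2)[%classic).
  by move=> i j; rewrite (ord1 i); apply: open_nbhs_nbhs; split => //; exact: xq.
by move=> y yq i; exact: (yq ord0 i).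
Qed.

Lemma nbhs_rat_itv (z : R) (U : set R) : nbhs z U ->
  exists q : rat * rat, (z \in `](ratr q.1), (ratr q.2)[) /\
    (`](ratr q.1), (ratr q.2)[%classic `<=` U).
Proof.
move=> /nbhs_ballP[e /= e0 eU].
have [p] : exists p : rat, ratr p \in `](z - e), z[.
  by apply: rat_in_itvoo; rewrite ltrBlDr ltrDl.
have [q] : exists q : rat, ratr q \in `]z, (z + e)[.
  by apply: rat_in_itvoo; rewrite ltrDl.
rewrite !in_itv /= => /andP[q1 q2] /andP[p1 p2].
exists (p, q); rewrite in_itv /= p2 q1; split => // y /=.
rewrite in_itv /= => /andP[y1 y2]; apply: eU.
by rewrite /ball /= ltr_norml; apply/andP; split; lra.
Qed.

Lemma nbhs_rat_box x (U : set 'rV[R]_m) : nbhs x U ->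
  exists q, rat_box q x /\ rat_box q `<=` U.
Proof.
move=> [P xP PU].
have H i : exists q : rat * rat, (x ord0 i \in `](ratr q.1), (ratr q.2)[) /\
    (`](ratr q.1), (ratr q.2)[%classic `<=` P ord0 i) by apply: nbhs_rat_itv; exact: xP.
have [q qP] := choice H.
exists [ffun i => q i]; split=> [i|y yq].
  by rewrite ffunE; case: (qP i).
apply: PU => i j; rewrite (ord1 i); case: (qP j) => _; apply => /=.
by have := yq j; rewrite ffunE.
Qed.

Lemma second_countable_rV : @second_countable 'rV[R]_m.
Proof.
exists (range rat_box); first exact: (sub_countable (card_image_le _ _)).
split=> [U [q _ <-]|x U /nbhs_rat_box[q [xq qU]]]; first exact: open_rat_box.
by exists (rat_box q) => //; split => //; exists q.
Qed.

Definition cbox a b : set 'rV[R]_m := [set x | forall i, a i <= x ord0 i <= b i].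

Lemma compact_cbox a b : compact (cbox a b).
Proof.
apply: (@rV_compact R m (fun i => [set z | a i <= z <= b i])) => i.
have -> : [set z | a i <= z <= b i] = `[a i, b i]%classic.
  by apply/seteqP; split => z /=; rewrite in_itv.
exact: segment_compact.
Qed.

Lemma closed_cbox a b : closed (cbox a b).
Proof.
exact: (compact_closed (@norm_hausdorff R 'rV[R]_m) (@compact_cbox a b)).
Qed.

Lemma not_compact_rV : (0 < m)%N -> ~ compact [set: 'rV[R]_m].
Proof.
move=> m0 /compact_bounded [K [_ /(_ (K + 1))]]; rewrite ltrDl ltr01 => /(_ isT) HK.
have : `|(const_mx (K + 2) : 'rV[R]_m) ord0 (Ordinal m0)| <= K + 1.
  apply: le_trans (HK (const_mx (K + 2)) I).
  by rewrite [leRHS]/Num.Def.normr /= mx_normrE; exact: (le_bigmax _ _ (ord0, Ordinal m0)).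
rewrite mxE => H; have := le_trans (ler_norm _) H; lra.
Qed.

End boxes.

Section volume.
Context {R : realType}.

Definition borel_rV m : measurableType _ := g_sigma_algebraType (@open 'rV[R]_m).

Definition row_of m (t : m.-tuple (measurableTypeR R)) : borel_rV m :=
  (\row_k tnth t k : 'rV[R]_m).

(** Every open set is a countable union of rational boxes, whose preimages are
    finite intersections of preimages of intervals. *)
Lemma measurable_row_of m : measurable_fun [set: _] (@row_of m).
Proof.
apply: (@measurability _ _ _ (borel_rV m) setT (@row_of m) (@open 'rV[R]_m) erefl) => // _ [U oU <-].
rewrite setTI.
have -> : @row_of m @^-1` U =
    \bigcup_(q : {ffun 'I_m -> rat * rat})
      (if `[< rat_box q `<=` U >] then @row_of m @^-1` rat_box q else set0).
  apply/seteqP; split=> [t Ut|t [q _]].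
    have /nbhs_rat_box[q [tq qU]] : nbhs (row_of t : 'rV[R]_m) U.
      exact: open_nbhs_nbhs.
    by exists q => //; case: asboolP.
  by case: asboolP => // qU; exact: qU.
apply: countable_bigcupT_measurable => // q; case: asboolP => // _.
have -> : @row_of m @^-1` rat_box q =
    \bigcap_(i in [set: 'I_m]) (@tnth m (measurableTypeR R) ^~ i @^-1`
      `](ratr (q i).1), (ratr (q i).2)[%classic).
  apply/seteqP; split=> [t tq i _|t tq i]; first by have := tq i; rewrite mxE.
  by rewrite mxE; exact: (tq i I).
apply: fin_bigcap_measurable => // i _; rewrite -[_ @^-1` _]setTI.
by apply: measurable_tnth => //; exact: measurable_itv.
Qed.

Lemma lebesgue_tuple_cbox m (a b : 'I_m -> R) : (forall i, a i <= b i) ->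
  lebesgue_tuple m [set t | forall i, a i <= tnth t i <= b i]
  = (\prod_i (b i - a i))%:E.
Proof.
elim: m a b => [|m IH] a b ab.
  rewrite big_ord0 /= (_ : [set _ | _] = setT) ?diracT//.
  by apply/seteqP; split => // t _ [].
pose A : set (m.-tuple (measurableTypeR R)) :=
  [set t | forall i, a (lift ord0 i) <= tnth t i <= b (lift ord0 i)].
have mA : measurable A.
  have -> : A = \bigcap_(i in [set: 'I_m]) (@tnth m (measurableTypeR R) ^~ i @^-1`
      `[a (lift ord0 i), b (lift ord0 i)]%classic).
    by apply/seteqP; split=> t At i => [_|]; [exact: At|exact: (At i I)].
  apply: fin_bigcap_measurable => // i _; rewrite -[_ @^-1` _]setTI.
  by apply: measurable_tnth => //; exact: measurable_itv.
rewrite /= /lebesgue_tuple_step /pushforward.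
have -> : @tuple_cons R m @^-1` [set t | forall i, a i <= tnth t i <= b i] =
    `[a ord0, b ord0]%classic `*` A.
  apply/seteqP; split=> [[x t] /= H|[x t] /= [x0 At] i].
    split; first by have := H ord0; rewrite in_itv.
    by move=> i; have := H (lift ord0 i); rewrite tnthS.
  have [j ->|->] := unliftP ord0 i; first by rewrite tnthS; exact: At.
  by move: x0; rewrite in_itv tnth0.
rewrite product_measure1E//.
rewrite big_ord_recl EFinM; congr (_ * _)%E; last by apply: IH => i; exact: ab.
apply: (etrans (@lebesgue_measure_itv R `[a ord0, b ord0])).
rewrite /= lte_fin; case: ltP => // ba.
by apply/esym/eqP; rewrite EFinB eqe subr_eq0 eq_le ba ab.
Qed.

Definition euclid_vol m (c : {nonneg R}) : {measure set (borel_rV m) -> \bar R} :=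
  mscale c (measure_function_pushforward__canonical__measure_function_Measure
     (lebesgue_tuple m) (@measurable_row_of m)).

Lemma measurable_cbox m (a b : 'I_m -> R) :
  measurable (cbox a b : set (borel_rV m)).
Proof.
rewrite -[cbox a b]setCK; apply: measurableC; apply: sub_sigma_algebra.
exact/closed_openC/closed_cbox.
Qed.

Lemma euclid_vol_cbox m (c : {nonneg R}) (a b : 'I_m -> R) : (forall i, a i <= b i) ->
  euclid_vol m c (cbox a b) = (c%:num * \prod_i (b i - a i))%:E.
Proof.
move=> ab; rewrite EFinM -lebesgue_tuple_cbox//.
rewrite /euclid_vol /mscale /= /pushforward; congr (_ * lebesgue_tuple m _)%E.
by apply/seteqP; split=> t H i; have := H i; rewrite mxE.
Qed.

End volume.

(** * The warped metric *)

Section hyperbolic.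
Context {R : realType}.
Implicit Types s : R.

Definition cosh s : R := (expR s + expR (- s)) / 2.
Definition sinh s : R := (expR s - expR (- s)) / 2.
Definition tanh s : R := sinh s / cosh s.

Lemma cosh_gt0 s : 0 < cosh s.
Proof. by rewrite divr_gt0// addr_gt0// expR_gt0. Qed.

Lemma cosh_neq0 s : cosh s != 0.
Proof. by rewrite gt_eqF// cosh_gt0. Qed.

Lemma cosh_sinh s : cosh s ^+ 2 = 1 + sinh s ^+ 2.
Proof.
have := expRxMexpNx_1 s; rewrite /cosh /sinh => H.
suff : (expR s + expR (- s)) ^+ 2 = 4 * (expR s * expR (- s)) + (expR s - expR (- s)) ^+ 2.
  by rewrite H => E; rewrite !expr_div_n E; lra.
by ring.
Qed.

Lemma is_derive_expRN s : is_derive s 1 (fun x : R => expR (- x)) (- expR (- s)).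
Proof.
apply: is_derive_eq (@is_derive1_comp R expR (fun x => - x) s _ _ (is_derive_expR _) (is_deriveNid s 1)) _.
by rewrite mulrN1.
Qed.

Lemma is_derive_cosh s : is_derive s 1 cosh (sinh s).
Proof.
have D := is_deriveD (is_derive_expR s) (is_derive_expRN s).
have := is_deriveM D (is_derive_cst (2^-1 : R) s 1).
by move=> D2; apply: (is_derive_eq D2); rewrite scaler0 add0r /GRing.scale /= mulrC.
Qed.

Lemma is_derive_sinh s : is_derive s 1 sinh (cosh s).
Proof.
have D := is_deriveB (is_derive_expR s) (is_derive_expRN s).
have := is_deriveM D (is_derive_cst (2^-1 : R) s 1).
move=> D2; apply: (is_derive_eq D2).
by rewrite scaler0 add0r /GRing.scale /= mulrC opprK.
Qed.

Lemma smooth1_cosh : smooth1 cosh.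
Proof.
have -> : cosh = (fun s => (expR s + expR (- 1 * s + 0)) * 2^-1).
  by apply/funext => s; rewrite mulN1r addr0.
apply: smooth1M; last exact: smooth1_cst.
by apply: smooth1D; [|apply: smooth1_affine]; exact: smooth1_expR.
Qed.

End hyperbolic.

Section metric.
Context {R : realType} {n : nat}.
Local Notation m := n.+2.
Implicit Types (x : 'rV[R]_m) (a b k : 'I_m) (s : R).

Definition i0 : 'I_m := ord0.
Definition i1 : 'I_m := Ordinal (isT : (1 < n.+2)%N).

(** Half the exponents of cosh in the diagonal entries of the metric. They add
    up to 0, which makes the volume form a constant multiple of Lebesgue
    measure and simplifies the Laplacian. *)
Definition half_exponent a : R := if a == i0 then 1 else if a == i1 then -1 else 0.

Definition weight a s : R :=
  if a == i0 then cosh s * cosh s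
  else if a == i1 then (cosh s * cosh s)^-1 else 1.

Lemma weight_gt0 a s : 0 < weight a s.
Proof.
rewrite /weight; have := cosh_gt0 s => c0.
have cc : 0 < cosh s * cosh s by exact: mulr_gt0.
by case: ifP => _ //; case: ifP => _ //; rewrite invr_gt0.
Qed.

Lemma weight_neq0 a s : weight a s != 0.
Proof. by rewrite gt_eqF// weight_gt0. Qed.

Lemma smooth1_weight a : smooth1 (weight a).
Proof.
have S : smooth1 (fun s : R => cosh s * cosh s).
  by apply: smooth1M; exact: smooth1_cosh.
rewrite /weight; case: (a == i0) => //; case: (a == i1); last exact: smooth1_cst.
by apply: smooth1V => // s; exact: (mulf_neq0 (cosh_neq0 s) (cosh_neq0 s)).
Qed.

Lemma is_derive_weight a s :
  is_derive s 1 (weight a) (2 * half_exponent a * tanh s * weight a s).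
Proof.
have D := is_deriveM (is_derive_cosh s) (is_derive_cosh s).
have c0 := cosh_neq0 s.
rewrite /weight /half_exponent; case: (a == i0); last case: (a == i1).
- by apply: (is_derive_eq D); rewrite /GRing.scale /= /tanh; field.
- have cc : ((@cosh R) * (@cosh R)) s != 0 by exact: (mulf_neq0 c0 c0).
  apply: (is_derive_eq (is_deriveV cc D)).
  by rewrite /GRing.scale /= /tanh !fctE; field.
- by rewrite mulr0 !mul0r; exact: is_derive_cst.
Qed.

Lemma big_i01 (F : 'I_m -> R) :
  \sum_a F a = F i0 + (F i1 + \sum_(a < n) F (lift ord0 (lift ord0 a))).
Proof.
rewrite !big_ord_recl (_ : lift ord0 ord0 = i1)//.
by apply: val_inj.
Qed.

Lemma sum_half_exponent : \sum_a half_exponent a = 0.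
Proof.
rewrite big_i01 big1 ?addr0; last by move=> i _; rewrite /half_exponent.
by rewrite /half_exponent eqxx /= subrr.
Qed.

Lemma prod_weight s : \prod_a weight a s = 1.
Proof.
rewrite !big_ord_recl big1; last by move=> i _; rewrite /weight.
by rewrite mulr1 /weight /= divff//; exact: (mulf_neq0 (cosh_neq0 s) (cosh_neq0 s)).
Qed.

Variables (mu : R) (mu0 : 0 < mu).

Definition gdiag x : 'rV[R]_m := \row_a (mu * weight a (x ord0 i0)).

Definition metric x : 'M[R]_m := diag_mx (gdiag x).

Lemma metricE x a b : metric x a b = (mu * weight a (x ord0 i0)) * (a == b)%:R.
Proof. by rewrite !mxE mulr_natr. Qed.

Lemma gdiag_gt0 x a : 0 < mu * weight a (x ord0 i0).
Proof. by rewrite mulr_gt0// weight_gt0. Qed.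

Lemma metric_smooth a b : smooth_on [set: 'rV[R]_m] (fun x => metric x a b).
Proof.
have -> : (fun x => metric x a b) =
    (fun x => (fun s => mu * (weight a s) * (a == b)%:R) (x ord0 i0)).
  by apply/funext => x; rewrite metricE.
apply: (@smooth_coord R m (fun s => mu * (weight a s) * (a == b)%:R)).
apply: smooth1M; last exact: smooth1_cst.
by apply: smooth1M; [exact: smooth1_cst|exact: smooth1_weight].
Qed.

Lemma metric_pos x (v : 'rV[R]_m) : v != 0 -> 0 < (v *m metric x *m v^T) ord0 ord0.
Proof.
move=> v0; have [a va] : exists a, v ord0 a != 0.
  apply/existsP; apply: contraNT v0 => /existsPn H; apply/eqP/rowP => a.
  by rewrite mxE; apply/eqP; move: (H a); rewrite negbK.
have E : (v *m metric x *m v^T) ord0 ord0 =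
    \sum_b (mu * weight b (x ord0 i0)) * v ord0 b ^+ 2.
  rewrite mxE; apply: eq_bigr => b _; rewrite mul_mx_diag !mxE expr2.
  by ring.
rewrite E (bigD1 a)//= ltr_wpDr//; last by rewrite mulr_gt0 ?gdiag_gt0// exprn_even_gt0.
by apply: sumr_ge0 => b _; rewrite mulr_ge0 ?sqr_ge0// ltW// gdiag_gt0.
Qed.

Lemma det_metric x : \det (metric x) = mu ^+ m.
Proof.
rewrite det_diag (eq_bigr (fun a => mu * weight a (x ord0 i0))); last first.
  by move=> a _; rewrite mxE.
by rewrite big_split /= prod_weight mulr1 prodr_const card_ord.
Qed.

Lemma inv_metricE x a b :
  invmx (metric x) a b = (mu * weight a (x ord0 i0))^-1 * (a == b)%:R.
Proof.
suff -> : invmx (metric x) = diag_mx (\row_a (mu * weight a (x ord0 i0))^-1).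
  by rewrite !mxE mulr_natr.
have U : metric x \in unitmx.
  by rewrite unitmxE det_metric unitfE expf_neq0// gt_eqF.
apply: (can_inj (mulKmx U)); rewrite mulmxV//.
apply/matrixP => i j; rewrite /metric mul_diag_mx !mxE.
case: eqVneq => [->|_]; last by rewrite mulr0n mulr0.
by rewrite mulr1n divff// gt_eqF// gdiag_gt0.
Qed.

Lemma open_image_id : open (@id 'rV[R]_m @` [set: 'rV[R]_m]).
Proof. by rewrite image_id; exact: openT. Qed.

Definition id_chart : chart R m 'rV[R]_m :=
  @Chart R m 'rV[R]_m [set: 'rV[R]_m] id id openT open_image_id
    (fun _ _ => erefl) (fun _ _ => cvg_id) (fun _ _ => cvg_id).

Lemma overlap_id : overlap id_chart id_chart = [set: 'rV[R]_m].
Proof. by rewrite /overlap /= setTI image_id. Qed.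

Lemma transition_smooth b :
  smooth_on (overlap id_chart id_chart)
    (fun x => transition id_chart id_chart x ord0 b).
Proof. by rewrite overlap_id; apply: (@smooth_coord R m id); exact: smooth1_id. Qed.

Definition euclidean_manifold : manifold R m :=
  @Manifold R m 'rV[R]_m (@norm_hausdorff R 'rV[R]_m) second_countable_rV
    unit (fun=> id_chart) (fun=> tt) (fun=> I) (fun _ _ => transition_smooth).

Lemma jacobian_id x : transition_jacobian id_chart id_chart x = 1%:M.
Proof.
apply/matrixP => a b; rewrite !mxE /partial.
have [_ ->] := @is_derive_coord R m id 1 b a x (is_derive_id _ _).
by rewrite mul1r eq_sym.
Qed.

Lemma chart_imageT : @chart_image R m euclidean_manifold tt = [set: 'rV[R]_m].
Proof. by rewrite /chart_image /= image_id. Qed.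

Definition warped : riemannian_manifold R m.
Proof.
refine (@RiemannianManifold R m euclidean_manifold (fun=> metric) _ _ _ _).
- by move=> [] a b; rewrite chart_imageT; exact: metric_smooth.
- by move=> [] x _; exact: tr_diag_mx.
- by move=> [] x _; exact: metric_pos.
- by move=> [] [] x _ /=; rewrite jacobian_id trmx1 mul1mx mulmx1.
Defined.

End metric.

(** * Christoffel symbols, Hessian and Laplacian of the warped metric *)

Section differential_operators.
Context {R : realType} {n : nat}.
Local Notation m := n.+2.
Variables (mu : R) (mu0 : 0 < mu).
Local Notation M := (@warped R n mu mu0).
Local Notation i0 := (@i0 n).
Local Notation i1 := (@i1 n).
Implicit Types (x : 'rV[R]_m) (a b k : 'I_m) (f : 'rV[R]_m -> R).

Lemma sum_single (F : 'I_m -> R) a :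
  (forall c, c != a -> F c = 0) -> \sum_c F c = F a.
Proof. by move=> F0; rewrite (bigD1 a)//= big1 ?addr0. Qed.

Lemma partial_metric c a b x :
  partial c (fun y => metric mu y a b) x
  = (a == b)%:R * (c == i0)%:R * (2 * half_exponent a * tanh (x ord0 i0))
    * (mu * weight a (x ord0 i0)).
Proof.
have -> : (fun y => metric mu y a b) =
    (fun y => (fun s => (mu * (a == b)%:R) * weight a s) (y ord0 i0)).
  by apply/funext => y; rewrite metricE; ring.
rewrite /partial.
have D : is_derive (x ord0 i0) 1 (fun s => (mu * (a == b)%:R) * weight a s)
    ((mu * (a == b)%:R) * (2 * half_exponent a * tanh (x ord0 i0) * weight a (x ord0 i0))).
  by apply: is_deriveZ; exact: is_derive_weight.
have [_ ->] := is_derive_coord c D.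
by rewrite (eq_sym i0 c); ring.
Qed.

Lemma christoffelE k a b x :
  @christoffel R m M tt k a b x
  = tanh (x ord0 i0) *
    (half_exponent k * ((a == i0)%:R * (b == k)%:R + (b == i0)%:R * (a == k)%:R)
     - (k == i0)%:R * (a == b)%:R * half_exponent a
       * (weight a (x ord0 i0) / weight i0 (x ord0 i0))).
Proof.
rewrite /christoffel (bigD1 k)//= big1 ?addr0; last first.
  move=> l lk; rewrite /inv_metric /= (inv_metricE mu0).
  by rewrite eq_sym (negbTE lk) mulr0 mul0r.
rewrite /inv_metric /= (inv_metricE mu0) !partial_metric eqxx mulr1.
set s := x ord0 i0.
have w0 c := weight_neq0 (n := n) c s; have m0 : mu != 0 by rewrite gt_eqF.
have B c : c = k -> (weight c s : R) = weight k s /\ (half_exponent c : R) = half_exponent k by move=> ->.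
case: (eqVneq b k) => [bk|_]; case: (eqVneq a k) => [ak|_];
  case: (eqVneq k i0) => [k0|_]; try (have [wb sb] := B _ bk; rewrite wb sb);
  try (have [wa sa] := B _ ak; rewrite wa sa); try rewrite -k0;
  by rewrite /=; field; rewrite ?m0 ?w0.
Qed.

Lemma hessianE f a b x :
  @hessian R m M tt f x a b
  = partial a (partial b f) x
    - \sum_k @christoffel R m M tt k a b x * partial k f x.
Proof. by rewrite /hessian mxE. Qed.

Lemma hessian_diagE f a x :
  @hessian R m M tt f x a a
  = partial a (partial a f) x
    - tanh (x ord0 i0) * (2 * (a == i0)%:R
       - half_exponent a * (weight a (x ord0 i0) / weight i0 (x ord0 i0))) * partial i0 f x.
Proof.
rewrite hessianE; congr (_ - _).
under eq_bigr do rewrite christoffelE eqxx mulr1.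
set s := x ord0 i0.
pose T1 k : R := tanh s * half_exponent k * (2 * (a == i0)%:R) * (a == k)%:R * partial k f x.
pose T2 k : R := (k == i0)%:R * (tanh s * half_exponent a * (weight a s / weight i0 s)) * partial k f x.
rewrite (eq_bigr (fun k => T1 k - T2 k)); last by move=> k _; rewrite /T1 /T2; ring.
rewrite sumrB.
have -> : \sum_k T1 k = tanh s * 2 * (a == i0)%:R * partial i0 f x.
  rewrite (bigD1 a)//= big1 ?addr0 /T1; last first.
    by move=> k /negbTE; rewrite eq_sym => ->; rewrite mulr0 mul0r.
  rewrite eqxx mulr1; case: eqVneq => [->|_]; last by rewrite !(mulr0, mul0r).
  by rewrite /half_exponent eqxx; ring.
have -> : \sum_k T2 k = tanh s * half_exponent a * (weight a s / weight i0 s) * partial i0 f x.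
  rewrite (bigD1 i0)//= big1 ?addr0 /T2; first by rewrite eqxx mul1r.
  by move=> k /negbTE ->; rewrite !mul0r.
by ring.
Qed.

(** The first order terms of the diagonal entries of the Hessian that are
    proportional to [half_exponent a] cancel in the trace, because the exponents of the
    metric add up to 0. *)
Lemma laplacianE (f : M -> R) (x : M) :
  laplacian f x
  = mu^-1 * (\sum_a (weight a ((x : 'rV[R]_m) ord0 i0))^-1 * partial a (partial a f) x
     - 2 * tanh ((x : 'rV[R]_m) ord0 i0) / weight i0 ((x : 'rV[R]_m) ord0 i0) * partial i0 f x).
Proof.
rewrite /laplacian /= /coords /=; set s := (x : 'rV[R]_m) ord0 i0.
have w0 c := weight_neq0 (n := n) c s; have m0 : mu != 0 by rewrite gt_eqF.
have E a : \sum_b @inv_metric R m M tt x a b * @hessian R m M tt f x a b =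
   mu^-1 * ((weight a s)^-1 * partial a (partial a f) x)
   - mu^-1 * (2 * tanh s / weight i0 s * partial i0 f x) * (a == i0)%:R
   + mu^-1 * (tanh s / weight i0 s * partial i0 f x) * half_exponent a.
  rewrite (bigD1 a)//= big1 ?addr0; last first.
    move=> b ba; rewrite /inv_metric /= (inv_metricE mu0).
    by rewrite eq_sym (negbTE ba) mulr0 mul0r.
  rewrite hessian_diagE /inv_metric /= (inv_metricE mu0) eqxx mulr1 -/s.
  by case: eqVneq => [->|_]; rewrite /=; field; rewrite ?m0 ?w0.
rewrite (eq_bigr _ (fun a _ => E a)) big_split /= sumrB.
rewrite -[X in _ + X]mulr_sumr sum_half_exponent mulr0 addr0 -[X in X - _]mulr_sumr.
have D c : \sum_a c * (a == i0)%:R = c.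
  rewrite (bigD1 i0)// eqxx mulr1 big1 /= ?addr0// => a /negbTE ->.
  by rewrite mulr0.
by rewrite D mulrBr.
Qed.

(** The metric being diagonal, the squared norm is a sum of squares, of which
    only the one for the direction x_1 is kept. *)
Lemma hessian_norm_ge (f : M -> R) (x : M) :
  mu^-1 * `|(weight i1 ((x : 'rV[R]_m) ord0 i0))^-1 * partial i1 (partial i1 f) x
     - tanh ((x : 'rV[R]_m) ord0 i0) / weight i0 ((x : 'rV[R]_m) ord0 i0) * partial i0 f x|
  <= hessian_norm f x.
Proof.
rewrite /hessian_norm /= /coords /=; set s := (x : 'rV[R]_m) ord0 i0.
have w0 c := weight_neq0 (n := n) c s; have m0 : mu != 0 by rewrite gt_eqF.
set H := @hessian R m M tt f x; set X := (X in Num.sqrt X).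
have HX : X = \sum_a \sum_b (mu * weight a s)^-1 * (mu * weight b s)^-1 * H a b ^+ 2.
  apply: eq_bigr => a _; apply: eq_bigr => b _.
  rewrite (@sum_single _ a); last first.
    move=> c ca; rewrite big1// => d _.
    rewrite /inv_metric /= (inv_metricE mu0 x a c) eq_sym (negbTE ca) mulr0.
    by rewrite !mul0r.
  rewrite (@sum_single _ b); last first.
    move=> d db; rewrite /inv_metric /= (inv_metricE mu0 x b d) eq_sym (negbTE db) !mulr0.
    by rewrite !mul0r.
  by rewrite /inv_metric /= !(inv_metricE mu0) !eqxx !mulr1 expr2 -/s; ring.
have G0 a : 0 <= (mu * weight a s)^-1 by rewrite invr_ge0 ltW// gdiag_gt0.
have T0 a b : 0 <= (mu * weight a s)^-1 * (mu * weight b s)^-1 * H a b ^+ 2.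
  by apply: mulr_ge0; [exact: mulr_ge0|exact: sqr_ge0].
have X1 : ((mu * weight i1 s)^-1 * H i1 i1) ^+ 2 <= X.
  rewrite HX (bigD1 i1)//= (bigD1 i1)//= -addrA.
  rewrite [leLHS](_ : _ = (mu * weight i1 s)^-1 * (mu * weight i1 s)^-1 * H i1 i1 ^+ 2); last by ring.
  rewrite lerDl addr_ge0//.
    by apply: sumr_ge0 => b _; exact: T0.
  by apply: sumr_ge0 => a _; apply: sumr_ge0 => b _; exact: T0.
apply: le_trans (_ : Num.sqrt (((mu * weight i1 s)^-1 * H i1 i1) ^+ 2) <= _); last by rewrite ler_wsqrtr.
rewrite sqrtr_sqr.
rewrite [leRHS](_ : _ = mu^-1 * `|(weight i1 s)^-1 * H i1 i1|); last first.
  by rewrite invfM -mulrA normrM ger0_norm// invr_ge0 ltW.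
rewrite ler_pM2l ?invr_gt0// /H hessian_diagE /= /half_exponent /= -/s.
rewrite le_eqVlt; apply/orP; left; apply/eqP; congr `|_|.
by field; rewrite ?w0.
Qed.

End differential_operators.

(** * Geodesics of the warped metric *)

Section asinh.
Context {R : realType}.
Implicit Types z s : R.

Definition asinh z : R := ln (z + Num.sqrt (1 + z ^+ 2)).

Lemma sqrt_sinh s : Num.sqrt (1 + sinh s ^+ 2) = cosh s.
Proof. by rewrite -cosh_sinh sqrtr_sqr ger0_norm// ltW// cosh_gt0. Qed.

Lemma sinhK : cancel (@sinh R) asinh.
Proof.
move=> s; rewrite /asinh sqrt_sinh.
rewrite (_ : sinh s + cosh s = expR s) ?expRK//.
by rewrite /sinh /cosh; field.
Qed.

Lemma asinhK : cancel asinh (@sinh R).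
Proof.
move=> z; have h : 0 <= 1 + z ^+ 2 by rewrite addr_ge0// sqr_ge0.
have [q0 q2] : 0 <= Num.sqrt (1 + z ^+ 2) /\ Num.sqrt (1 + z ^+ 2) ^+ 2 = 1 + z ^+ 2.
  by rewrite sqrtr_ge0 sqr_sqrtr.
set q := Num.sqrt _ in q0 q2.
have zq : 0 < z + q.
  rewrite -ltrBlDl sub0r; have [z0|z0] := ltP (- z) 0; first exact: lt_le_trans q0.
  by rewrite -(ltr_pXn2r (n := 2)) ?nnegrE// q2 sqrrN ltrDr.
rewrite /sinh expRN /asinh -/q lnK ?posrE//.
have -> : (z + q)^-1 = q - z.
  apply: (mulfI (lt0r_neq0 zq)); rewrite divff ?lt0r_neq0//.
  rewrite (_ : (z + q) * (q - z) = q ^+ 2 - z ^+ 2); last by ring.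
  by rewrite q2 addrK.
by field.
Qed.

Lemma is_derive_asinh z : is_derive z 1 asinh (cosh (asinh z))^-1.
Proof.
have K : {near asinh z, cancel (@sinh R) asinh} by near=> s; exact: sinhK.
have C : {near asinh z, continuous (@sinh R)}.
  near=> s; apply: differentiable_continuous; apply/derivable1_diffP.
  by case: (is_derive_sinh s).
rewrite -{1}(asinhK z).
exact: (is_derive_inverse K C (is_derive_sinh _) (cosh_neq0 _)).
Unshelve. all: by end_near. Qed.

End asinh.

Section oscillator.
Context {R : realType}.
Implicit Types c t : R.

Lemma is_derive_scale_comp (f : R -> R) (df : R) c t :
  is_derive (c * t) 1 f df -> is_derive t 1 (fun y => f (c * y)) (df * c).
Proof.
move=> fdf; have -> : (fun y => f (c * y)) = (fun y => f (c * y + 0)).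
  by apply/funext => y; rewrite addr0.
by apply: is_derive_affine; rewrite addr0.
Qed.

(** This is the equation of r = sinh x_0 along a geodesic. *)
Lemma oscillator c (r0 v0 : R) : exists r r1 : R -> R,
  [/\ r 0 = r0, r1 0 = v0,
    forall t, is_derive t 1 r (r1 t) &
    forall t, is_derive t 1 r1 (- c ^+ 2 * r t)].
Proof.
have [->|c0] := eqVneq c 0.
  exists (fun t => v0 * t + r0), (fun=> v0); split => //.
  - by rewrite mulr0 add0r.
  - move=> t; have := @is_derive_affine R id v0 r0 t 1 (is_derive_id _ _).
    by rewrite mul1r.
  - by move=> t; rewrite expr0n /= oppr0 mul0r; exact: is_derive_cst.
have Ds (t : R) : is_derive t 1 (fun y => sin (c * y)) (cos (c * t) * c).
  exact: is_derive_scale_comp.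
have Dc t : is_derive t 1 (fun y => cos (c * y)) (- sin (c * t) * c).
  exact: is_derive_scale_comp.
exists (fun t => r0 * cos (c * t) + v0 / c * sin (c * t)),
  (fun t => - (r0 * c) * sin (c * t) + v0 * cos (c * t)); split.
- by rewrite mulr0 cos0 sin0 mulr1 mulr0 addr0.
- by rewrite mulr0 cos0 sin0 mulr1 mulr0 add0r.
- move=> t; have D := is_deriveD (is_deriveZ r0 (Dc t)) (is_deriveZ (v0 / c) (Ds t)).
  by apply: (is_derive_eq D); rewrite /GRing.scale /=; field.
- move=> t; have D := is_deriveD (is_deriveZ (- (r0 * c)) (Ds t)) (is_deriveZ v0 (Dc t)).
  by apply: (is_derive_eq D); rewrite /GRing.scale /=; field.
Qed.

(** This is the coordinate x_1 along a geodesic. Conservation of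
    r1^2 + c^2 r^2 = E gives the primitive c t + (E t - r r1) / (2 c) of
    c (1 + r^2). *)
Lemma oscillator_primitive c (r r1 : R -> R) (y0 : R) :
  (forall t, is_derive t 1 r (r1 t)) ->
  (forall t, is_derive t 1 r1 (- c ^+ 2 * r t)) ->
  exists y : R -> R, y 0 = y0 /\ forall t, is_derive t 1 y (c * (1 + r t * r t)).
Proof.
move=> Dr Dr1; have [->|c0] := eqVneq c 0.
  by exists (fun=> y0); split=> // t; rewrite mul0r; exact: is_derive_cst.
pose E t := r1 t * r1 t + c ^+ 2 * (r t * r t).
have EE t : E t = E 0.
  apply: is_derive_0_is_cst => {}t.
  have D := is_deriveD (is_deriveM (Dr1 t) (Dr1 t)) (is_deriveZ (c ^+ 2) (is_deriveM (Dr t) (Dr t))).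
  by apply: (is_derive_eq D); rewrite /GRing.scale /=; ring.
pose y t := y0 + (c + E 0 / (2 * c)) * t + (- (2 * c)^-1) * (r t * r1 t) - (- (2 * c)^-1) * (r 0 * r1 0).
exists y; split; first by rewrite /y mulr0 addr0 addrK.
move=> t.
have D1 := is_deriveD (is_derive_cst y0 t 1) (is_deriveZ (c + E 0 / (2 * c)) (is_derive_id t (1 : R))).
have D2 := is_deriveZ (- (2 * c)^-1) (is_deriveM (Dr t) (Dr1 t)).
have D := is_deriveD (is_deriveD D1 D2) (is_derive_cst (- ((- (2 * c)^-1) * (r 0 * r1 0))) t (1 : R)).
apply: (is_derive_eq D); rewrite -(EE t) /E /GRing.scale /=.
by field.
Qed.

End oscillator.

Section completeness.
Context {R : realType} {n : nat}.
Local Notation m := n.+2.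
Variables (mu : R) (mu0 : 0 < mu).
Local Notation M := (@warped R n mu mu0).
Local Notation i0 := (@i0 n).
Local Notation i1 := (@i1 n).

Lemma christoffel_sum (x u : 'rV[R]_m) k :
  \sum_a \sum_b @christoffel R m M tt k a b x * u ord0 a * u ord0 b
  = tanh (x ord0 i0) * (2 * half_exponent k * u ord0 i0 * u ord0 k
     - (k == i0)%:R * (u ord0 i0 ^+ 2
         - weight i1 (x ord0 i0) / weight i0 (x ord0 i0) * u ord0 i1 ^+ 2)).
Proof.
set s := x ord0 i0.
pose D a : R := tanh s * half_exponent k * u ord0 a.
have E a : \sum_b @christoffel R m M tt k a b x * u ord0 a * u ord0 b =
    D a * u ord0 k * (a == i0)%:R + D a * u ord0 i0 * (a == k)%:R
    - tanh s * (k == i0)%:R * (half_exponent a * (weight a s / weight i0 s) * u ord0 a ^+ 2).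
  under eq_bigr do rewrite christoffelE -/s.
  pose A b : R := D a * (a == i0)%:R * u ord0 b * (b == k)%:R.
  pose B b : R := D a * (a == k)%:R * u ord0 b * (b == i0)%:R.
  pose C b : R := - (tanh s * (k == i0)%:R
    * (half_exponent a * (weight a s / weight i0 s) * u ord0 a)) * u ord0 b * (b == a)%:R.
  rewrite (eq_bigr (fun b => A b + B b + C b)); last first.
    by move=> b _; rewrite /A /B /C /D (eq_sym b a); ring.
  rewrite !big_split /= (@sum_single _ _ A k); last first.
    by move=> c /negbTE ck; rewrite /A ck mulr0.
  rewrite (@sum_single _ _ B i0); last by move=> c /negbTE ck; rewrite /B ck mulr0.
  rewrite (@sum_single _ _ C a); last by move=> c /negbTE ck; rewrite /C ck mulr0.
  by rewrite /A /B /C !eqxx /=; ring.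
rewrite (eq_bigr _ (fun a _ => E a)) sumrB big_split /=.
rewrite (@sum_single _ _ (fun a => D a * u ord0 k * (a == i0)%:R) i0); last first.
  by move=> c /negbTE ->; rewrite mulr0.
rewrite (@sum_single _ _ (fun a => D a * u ord0 i0 * (a == k)%:R) k); last first.
  by move=> c /negbTE ->; rewrite mulr0.
rewrite -mulr_sumr big_i01 big1; last by move=> a _; rewrite /half_exponent !mul0r.
have w0 c := weight_neq0 (n := n) c s.
rewrite !eqxx /D [half_exponent i0]/half_exponent [half_exponent i1]/half_exponent !eqxx /=.
by field; rewrite w0.
Qed.

(** The coordinate x_1 enters the metric only through its differential, so
    c = x_1' / cosh^2(x_0) is constant along geodesics, and the equation of
    x_0 becomes r'' = - c^2 r for r = sinh x_0; the other coordinates are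
    affine. Solving backwards from the initial data gives the geodesic. *)
Lemma warped_complete : geodesically_complete M.
Proof.
move=> q v; pose s0 := (q : 'rV[R]_m) ord0 i0.
(* the conserved quantity, read off the initial data *)
pose c := v ord0 i1 / (cosh s0 * cosh s0).
have [r [r1 [r0 r10 Dr Dr1]]] := oscillator c (sinh s0) (cosh s0 * v ord0 i0).
have [y [y0 Dy]] := oscillator_primitive ((q : 'rV[R]_m) ord0 i1) Dr Dr1.
pose s t := asinh (r t).
have rs t : r t = sinh (s t) by rewrite asinhK.
have cr t : 1 + r t * r t = cosh (s t) * cosh (s t).
  by rewrite rs -!expr2 -cosh_sinh.
pose s1 t := r1 t / cosh (s t).
have Ds (t : R) : is_derive t 1 s (s1 t).
  apply: (is_derive_eq (@is_derive1_comp R asinh r t _ _ (is_derive_asinh (r t)) (Dr t))).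
  by rewrite mulrC.
pose s2 t := - tanh (s t) * (s1 t ^+ 2 + c ^+ 2).
have Ds1 (t : R) : is_derive t 1 s1 (s2 t).
  have Dc : is_derive t 1 (fun t => cosh (s t)) (sinh (s t) * s1 t).
    exact: (@is_derive1_comp R (@cosh R) s t _ _ (is_derive_cosh _) (Ds t)).
  have D := is_deriveM (Dr1 t) (@is_deriveV R (fun t => cosh (s t)) t _ _ (cosh_neq0 _) Dc).
  apply: (is_derive_eq D); rewrite /s2 /s1 /tanh rs /GRing.scale /=.
  by field; exact: cosh_neq0.
pose y1 t := c * (cosh (s t) * cosh (s t)).
have Dy' (t : R) : is_derive t 1 y (y1 t) by rewrite /y1 -cr.
pose y2 t := 2 * tanh (s t) * s1 t * y1 t.
have Dy1 (t : R) : is_derive t 1 y1 (y2 t).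
  have Dc : is_derive t 1 (fun t => cosh (s t)) (sinh (s t) * s1 t).
    exact: (@is_derive1_comp R (@cosh R) s t _ _ (is_derive_cosh _) (Ds t)).
  have D := is_deriveZ c (is_deriveM Dc Dc).
  apply: (is_derive_eq D); rewrite /y2 /y1 /tanh /GRing.scale /=.
  by field; exact: cosh_neq0.
pose u k : R -> R := if k == i0 then s else if k == i1 then y
  else fun t => v ord0 k * t + (q : 'rV[R]_m) ord0 k.
pose u1 k : R -> R := if k == i0 then s1 else if k == i1 then y1
  else fun=> v ord0 k.
pose u2 k : R -> R := if k == i0 then s2 else if k == i1 then y2
  else fun=> 0.
have Du k (t : R) : is_derive t 1 (u k) (u1 k t).
  rewrite /u /u1; case: (k == i0) => //; case: (k == i1) => //.
  have := @is_derive_affine R id (v ord0 k) ((q : 'rV[R]_m) ord0 k) t 1 (is_derive_id _ _).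
  by rewrite mul1r.
have Du1 k (t : R) : is_derive t 1 (u1 k) (u2 k t).
  rewrite /u1 /u2; case: (k == i0) => //; case: (k == i1) => //.
  exact: is_derive_cst.
pose curve t : M := (\row_k u k t : 'rV[R]_m).
have curveE k : curve_coord curve tt k = u k.
  by apply/funext => t; rewrite /curve_coord /coords /= mxE.
exists curve; split.
- split.
    move=> t; apply: (@differentiable_continuous R R^o 'rV[R]_m).
    apply/derivable1_diffP; apply/derivable_mxP => i k.
    rewrite (_ : (fun t => _) = u k); first by case: (Du k t).
    by apply/funext => z; rewrite mxE.
  move=> t [] _ k; rewrite curveE (derive1_eq (Du k)).
  split; first by case: (Du k t).
    by case: (Du1 k t).
  rewrite (derive1_eq (Du1 k)).
  pose U : 'rV[R]_m := \row_k u1 k t.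
  under eq_bigr do under eq_bigr do rewrite !curveE !(derive1_eq (Du _)).
  rewrite (eq_bigr (fun a => \sum_b @christoffel R m M tt k a b (curve t) * U ord0 a * U ord0 b)); last first.
    by move=> a _; apply: eq_bigr => b _; rewrite !mxE.
  rewrite (christoffel_sum (curve t : 'rV[R]_m)) !mxE /u1 /u2 /u /half_exponent !eqxx /=.
  have ch := cosh_neq0 (s t).
  case: (k == i0); last case: (k == i1).
  + rewrite /weight !eqxx /= /y1 /s2 /tanh /=; field; exact: ch.
  + by rewrite /y2 mul0r; ring.
  + by rewrite !(mulr0, mul0r) subrr mulr0 addr0.
- apply/rowP => k; rewrite mxE /u; case: eqVneq => [->|_].
    by rewrite /s r0 sinhK.
  by case: eqVneq => [->|_] //; rewrite mulr0 add0r.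
- move=> k; rewrite curveE (derive1_eq (Du k)) /u1.
  have c0 := cosh_neq0 s0; have S0 : s 0 = s0 by rewrite /s r0 sinhK.
  case: eqVneq => [->|_]; first by rewrite /s1 r10 S0 mulrAC divff// mul1r.
  case: eqVneq => [->|_] //; rewrite /y1 S0 /c; field; exact: c0.
Qed.

Lemma warped_open : open_manifold M.
Proof. by split; [exact: not_compact_rV|exact: warped_complete]. Qed.

End completeness.

(** * Comparison of Lebesgue norms *)

Section Lp_comparison.
Context d (T : measurableType d) (R : realType).
Variable mu : {measure set T -> \bar R}.
Local Open Scope ereal_scope.

(** The integral of a nonnegative function is a supremum over the simple
    functions below it, hence it is monotone without measurability. This spares
    the measurability of the Hessian norm and of the Laplacian. *)
Lemma ge0_le_integralT (f1 f2 : T -> \bar R) : (forall x, 0 <= f1 x) ->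
  (forall x, f1 x <= f2 x) -> \int[mu]_x f1 x <= \int[mu]_x f2 x.
Proof.
move=> f10 f12; rewrite !ge0_integralTE//; last by move=> x; exact: le_trans (f12 x).
apply: le_ereal_sup => _ [h hf1 <-]; exists h => // x.
exact: le_trans (f12 x).
Qed.

Variables (B B' : set T) (mB : measurable B) (mB' : measurable B').
Variables (H V W : R) (H0 : (0 < H)%R) (V0 : (0 < V)%R).
Hypotheses (muB : mu B = V%:E) (muB' : mu B' = W%:E).

Lemma integral_powR_ge (h : T -> R) (r : R) : (1 <= r)%R ->
  (forall x, B x -> (H <= h x)%R) ->
  (H `^ r * V)%:E <= \int[mu]_x `|(EFin \o h) x| `^ r.
Proof.
move=> r1 Hh; rewrite EFinM -muB -(@integral_cst _ _ _ mu _ mB (H `^ r)%:E).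
rewrite integral_mkcond; apply: ge0_le_integralT => x; rewrite patchE.
  by case: ifP => // _; rewrite lee_fin powR_ge0.
case: ifP => [/set_mem/Hh Bx|_]; last exact: poweR_ge0.
rewrite /= lee_fin ge0_ler_powR ?nnegrE ?(ltW H0)//; last first.
  exact: le_trans (ler_norm _).
exact: le_trans r1.
Qed.

Lemma integral_powR_le (f : T -> R) (K r : R) : (1 <= r)%R ->
  (forall x, (`|f x| <= K)%R) -> (forall x, ~ B' x -> f x = 0%R) ->
  \int[mu]_x `|(EFin \o f) x| `^ r <= (K `^ r * W)%:E.
Proof.
move=> r1 fK f0; rewrite EFinM -muB' -(@integral_cst _ _ _ mu _ mB' (K `^ r)%:E).
rewrite [leRHS]integral_mkcond; apply: ge0_le_integralT => x; rewrite ?patchE.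
  exact: poweR_ge0.
case: ifPn => [_|/negP xB'].
  rewrite /= lee_fin ge0_ler_powR ?nnegrE//; last exact: le_trans (fK x).
  exact: le_trans r1.
rewrite /= f0; last by move=> /mem_set.
by rewrite normr0 powR0// gt_eqF// (lt_le_trans _ r1).
Qed.

(** When h is large on B while f and g are small and supported in B', the
    estimate fails for all exponents at once, because (delta K)^r <= delta K^r
    for 1 <= r. *)
Lemma Lnorm_estimate_fails (C1 C2 delta Q : R) (f g h : T -> R) (p : \bar R) :
  (0 < C1)%R -> (0 < C2)%R -> (0 < delta <= 1)%R -> (1 <= Q)%R -> W = (Q * V)%R ->
  ((C1 + C2) * Q * delta < 1)%R ->
  (forall x, B x -> (H <= h x)%R) ->
  (forall x, (`|f x| <= delta * H)%R) -> (forall x, ~ B' x -> f x = 0%R) ->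
  (forall x, (`|g x| <= delta * H)%R) -> (forall x, ~ B' x -> g x = 0%R) ->
  1 <= p ->
  (forall r : R, p = r%:E ->
     C1%:E * 'N[mu]_p[EFin \o g] `^ r + C2%:E * 'N[mu]_p[EFin \o f] `^ r
     < 'N[mu]_p[EFin \o h] `^ r) /\
  (p = +oo ->
     C1%:E * 'N[mu]_p[EFin \o g] + C2%:E * 'N[mu]_p[EFin \o f]
     < 'N[mu]_p[EFin \o h]).
Proof.
move=> C10 C20 /andP[d0 d1] Q1 WE small Hh fK f0 gK g0 p1; split.
  move=> r pr; rewrite pr lee_fin in p1; rewrite pr.
  have r0 : (r != 0)%R by rewrite gt_eqF// (lt_le_trans _ p1).
  rewrite !poweR_Lnorm//.
  apply: lt_le_trans (integral_powR_ge p1 Hh).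
  apply: (@le_lt_trans _ _ ((C1 * ((delta * H) `^ r * W)
      + C2 * ((delta * H) `^ r * W))%R%:E)).
    rewrite EFinD !(EFinM C1) !(EFinM C2); apply: leeD; rewrite lee_pmul2l ?lte_fin//.
      exact: integral_powR_le.
    exact: integral_powR_le.
  have Hr0 : (0 < H `^ r)%R by rewrite powR_gt0.
  have le1 : ((delta * H) `^ r <= delta * H `^ r)%R.
    by apply: ge1r_powRZ => //; rewrite ?d0// ltW.
  have W0 : (0 <= W)%R by rewrite WE mulr_ge0 ?(ltW V0)// (le_trans _ Q1).
  rewrite lte_fin -mulrDl.
  apply: (@le_lt_trans _ _ ((C1 + C2) * (delta * H `^ r * W))%R).
    by rewrite ler_wpM2l ?ler_wpM2r// addr_ge0// ltW.
  rewrite WE [ltLHS](_ : _ = ((C1 + C2) * Q * delta) * (H `^ r * V))%R; last by ring.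
  by rewrite gtr_pMl// mulr_gt0.
move=> ->.
have muT : 0 < mu [set: T].
  have BT : mu B <= mu [set: T] by apply: le_measure; rewrite ?inE.
  by apply: lt_le_trans BT; rewrite muB lte_fin.
have up (u : T -> R) : (forall x, (`|u x| <= delta * H)%R) ->
    'N[mu]_+oo[EFin \o u] <= (delta * H)%:E.
  move=> uK; rewrite unlock muT; apply/ess_supP; apply: nearW => x /=.
  by rewrite lee_fin.
have low : H%:E <= 'N[mu]_+oo[EFin \o h].
  rewrite unlock muT leNgt; apply/negP => lt.
  have : mu.-negligible B.
    apply: negligibleS (ess_sup_ge mu (abse \o (EFin \o h))) => x /Hh Hx /= le.
    have := le_lt_trans le lt; rewrite lte_fin ltNge => /negP; apply.
    exact: le_trans (ler_norm _).
  by move=> /measure_negligible => /(_ mB) B0; move: V0; rewrite -lte_fin -muB B0 ltxx.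
apply: lt_le_trans low.
apply: (@le_lt_trans _ _ ((C1 * (delta * H) + C2 * (delta * H))%R%:E)).
  by rewrite EFinD !(EFinM C1) !(EFinM C2); apply: leeD; rewrite lee_pmul2l ?lte_fin// up.
rewrite lte_fin -mulrDl mulrA gtr_pMl//; apply: le_lt_trans small.
by rewrite mulrAC ler_peMr// mulr_ge0 ?addr_ge0 ?ltW.
Qed.

End Lp_comparison.

(** * The test function *)

Section hyperbolic_bounds.
Context {R : realType}.
Implicit Types s N : R.

Lemma expR_le_cosh s : expR s <= 2 * cosh s.
Proof. by rewrite /cosh mulrC divfK// lerDl expR_ge0. Qed.

Lemma cosh_le_expR s : 0 <= s -> cosh s <= expR s.
Proof.
move=> s0; rewrite /cosh ler_pdivrMr// mulr_natr mulr2n lerD2l ler_expR.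
by rewrite ge0_cp.
Qed.

Lemma tanh_le1 s : tanh s <= 1.
Proof.
rewrite /tanh ler_pdivrMr ?cosh_gt0// mul1r /sinh /cosh ler_pM2r ?invr_gt0//.
by have := expR_ge0 (- s); lra.
Qed.

(** 1 - tanh s is of the order of exp(-2 s), but the rate 1/N of the other
    error terms is all that matters. *)
Lemma tanh_close s N : 0 < N -> 2 * N <= s -> 1 - tanh s <= N^-1.
Proof.
move=> N0 sN; have ch := cosh_gt0 s.
have -> : 1 - tanh s = expR (- s) / cosh s.
  rewrite /tanh; apply: (mulIf (cosh_neq0 s)); rewrite divfK ?cosh_neq0//.
  by rewrite mulrBl divfK ?cosh_neq0// mul1r /cosh /sinh; lra.
rewrite ler_pdivrMr// -[leLHS](mulKf (lt0r_neq0 N0)) ler_wpM2l ?invr_ge0 ?(ltW N0)//.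
apply: (@le_trans _ _ N); first by rewrite ler_piMr ?(ltW N0)// expR_le1; lra.
have := expR_le_cosh s; have := expR_ge1Dx s; lra.
Qed.

End hyperbolic_bounds.

Section test_function.
Context {R : realType} {n : nat}.
Local Notation m := n.+2.
Local Notation i0 := (@i0 n).
Local Notation i1 := (@i1 n).
Implicit Types (x : 'rV[R]_m) (a k : 'I_m) (s z : R) (j : nat) (d : 'I_m -> nat).

Lemma prodr_le1 (I : finType) (P : pred I) (F : I -> R) :
  (forall i, P i -> 0 <= F i <= 1) -> \prod_(i | P i) F i <= 1.
Proof.
move=> F01; rewrite -[leRHS](@big1_eq R 1 *%R I (index_enum I) P).
exact: ler_prod.
Qed.

Lemma derive1n_affine (f : R -> R) (a b : R) j z : smooth1 f ->
  derive1n j (fun y => f (a * y + b)) z = a ^+ j * derive1n j f (a * z + b).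
Proof.
move=> sf; elim: j z => [|j IH] z; first by rewrite expr0 mul1r.
rewrite derive1nS (_ : derive1n j _ = fun z => a ^+ j * derive1n j f (a * z + b)); last exact/funext.
rewrite derive1E.
have D : is_derive z 1 (fun z => a ^+ j * derive1n j f (a * z + b))
    (a ^+ j *: (derive1n j.+1 f (a * z + b) * a)).
  by apply: is_deriveZ; apply: is_derive_affine; exact: smooth1_derive.
by case: D => _ ->; rewrite /GRing.scale /= exprS; ring.
Qed.

Variables (N L : R) (N2 : 2 <= N) (L1 : 1 <= L).

Let N0 : 0 < N. Proof. exact: lt_le_trans N2. Qed.
Let L0 : 0 < L. Proof. exact: lt_le_trans L1. Qed.

(** exp(2 s) is nearly harmonic for large s; it is cut off outside [2N, 4N]. *)
Definition radial s : R := expR (2 * s + 0) * bump (N^-1 * s + - 3).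

Definition factor k : R -> R :=
  if k == i0 then radial else fun z => bump (L^-1 * z + 0).

Definition test x : R := tensor factor (fun=> 0%N) x.

Lemma smooth1_factor k : smooth1 (factor k).
Proof.
rewrite /factor; case: (k == i0); last exact/smooth1_affine/smooth1_bump.
by apply: smooth1M; apply: smooth1_affine; [exact: smooth1_expR|exact: smooth1_bump].
Qed.

Definition dir a : 'I_m -> nat := incr (fun=> 0%N) a.

Lemma partial_test a : partial a test = tensor factor (dir a).
Proof. exact/partial_tensor/smooth1_factor. Qed.

Lemma partial2_test a : partial a (partial a test) = tensor factor (incr (dir a) a).
Proof. by rewrite partial_test; exact/partial_tensor/smooth1_factor. Qed.

Definition center k : R := if k == i0 then 3 * N else 0.
Definition radius k : R := if k == i0 then N else L.

(** The support of the test function is the box with t = 1; its Hessian is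
    bounded below on the box with t = 1/2. *)
Definition tbox (t : R) : set 'rV[R]_m :=
  cbox (fun k => center k - t * radius k) (fun k => center k + t * radius k).

Lemma radius_gt0 k : 0 < radius k.
Proof. by rewrite /radius; case: ifP. Qed.

(** The argument of the bump in the k-th factor, which rescales the k-th side
    of the support to [-1, 1]. *)
Definition arg k z : R := if k == i0 then N^-1 * z + - 3 else L^-1 * z + 0.

Lemma argE k z : arg k z = (z - center k) / radius k.
Proof.
rewrite /arg /center /radius; case: ifP => _; first by field; rewrite gt_eqF.
by rewrite subr0 addr0 mulrC.
Qed.

Lemma tboxP t x : tbox t x <-> forall k, `|arg k (x ord0 k)| <= t.
Proof.
have E k : (center k - t * radius k <= x ord0 k <= center k + t * radius k)
    = (`|arg k (x ord0 k)| <= t).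
  rewrite argE normrM normfV (gtr0_norm (radius_gt0 k)).
  by rewrite ler_pdivrMr ?radius_gt0// ler_distl.
by split=> H k; have := H k; rewrite E.
Qed.

Lemma factor_out k j z : 1 < `|arg k z| -> derive1n j (factor k) z = 0.
Proof.
rewrite /arg /factor; case: (k == i0) => z1.
  apply: (@derive1n_out _ _ N^-1 (- 3)) => // y y1.
  by rewrite /radial bump_out// mulr0.
by apply: (@derive1n_out _ _ L^-1 0) => // y y1; rewrite bump_out.
Qed.

Lemma tensor_out d x : ~ tbox 1 x -> tensor factor d x = 0.
Proof.
move=> xB; have [k k1] : exists k, 1 < `|arg k (x ord0 k)|.
  apply: contrapT => H; apply: xB; apply/tboxP => k.
  by rewrite leNgt; apply/negP => k1; apply: H; exists k.
by rewrite /tensor (bigD1 k)//= factor_out// mul0r.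
Qed.

Lemma test_out x : ~ tbox 1 x -> test x = 0.
Proof. exact: tensor_out. Qed.

Lemma radial_ge0 s : 0 <= radial s.
Proof. by rewrite mulr_ge0 ?expR_ge0 ?bump_ge0. Qed.

Lemma radial_le s : radial s <= expR (2 * s).
Proof. by rewrite /radial addr0 ler_piMr ?expR_ge0 ?bump_le1. Qed.

Local Notation bd j s := (derive1n j bump (N^-1 * s + - 3)).

Lemma is_derive_radial s : is_derive s 1 radial
  (expR (2 * s + 0) * (2 * bd 0 s + N^-1 * bd 1 s)).
Proof.
have De : is_derive s 1 (fun s => expR (2 * s + 0)) (expR (2 * s + 0) * 2).
  by apply: is_derive_affine; exact: is_derive_expR.
have Db : is_derive s 1 (fun s => bd 0 s) (bd 1 s * N^-1).
  by apply: is_derive_affine; exact: (smooth1_derive 0 _ smooth1_bump).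
by apply: (is_derive_eq (is_deriveM De Db)); rewrite /GRing.scale /=; ring.
Qed.

Lemma radial1 s : derive1n 1 radial s = expR (2 * s + 0) * (2 * bd 0 s + N^-1 * bd 1 s).
Proof. by rewrite derive1n1 (derive1_eq is_derive_radial). Qed.

Lemma radial2 s : derive1n 2 radial s
  = expR (2 * s + 0) * (4 * bd 0 s + 4 * N^-1 * bd 1 s + N^-1 * N^-1 * bd 2 s).
Proof.
rewrite derive1nS derive1n1 (derive1_eq is_derive_radial) derive1E.
have De : is_derive s 1 (fun s => expR (2 * s + 0)) (expR (2 * s + 0) * 2).
  by apply: is_derive_affine; exact: is_derive_expR.
have Db j : is_derive s 1 (fun s => bd j s) (bd j.+1 s * N^-1).
  by apply: is_derive_affine; exact: (smooth1_derive j _ smooth1_bump).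
have D := is_deriveM De (is_deriveD (is_deriveZ 2 (Db 0%N)) (is_deriveZ N^-1 (Db 1%N))).
have [_ ->] := D.
rewrite [X in _ + X](_ : _ = (2 * bd 0 s + N^-1 * bd 1 s) * (expR (2 * s + 0) * 2))//.
by rewrite /GRing.scale /=; ring.
Qed.

Definition transverse d x : R :=
  \prod_(k | k != i0) derive1n (d k) (factor k) (x ord0 k).

Lemma tensor_split d x :
  tensor factor d x = derive1n (d i0) radial (x ord0 i0) * transverse d x.
Proof. by rewrite /tensor (bigD1 i0)//= {2}/factor eqxx. Qed.

Lemma transverse_dir0 x : transverse (dir i0) x = transverse (fun=> 0%N) x.
Proof.
by apply: eq_bigr => k /negbTE k0; rewrite /dir /incr k0.
Qed.

Lemma transverse_dir00 x :
  transverse (incr (dir i0) i0) x = transverse (fun=> 0%N) x.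
Proof.
by apply: eq_bigr => k /negbTE k0; rewrite /dir /incr k0.
Qed.

Lemma transverse_itv x : 0 <= transverse (fun=> 0%N) x <= 1.
Proof.
rewrite /transverse; apply/andP; split.
  by apply: prodr_ge0 => k /negbTE k0; rewrite /factor k0 bump_ge0.
by apply: prodr_le1 => k /negbTE k0; rewrite /factor k0 bump_ge0 bump_le1.
Qed.

Lemma transverse_ge x : tbox 2^-1 x ->
  bump_floor ^+ n.+1 <= transverse (fun=> 0%N) x.
Proof.
move=> /tboxP xB.
have -> : (bump_floor : R) ^+ n.+1 = \prod_(k : 'I_m | k != i0) bump_floor.
  rewrite prodr_const; congr (_ ^+ _).
  by rewrite (eq_card (B := predC1 i0))// cardC1 card_ord.
apply: ler_prod => k /negbTE k0; rewrite (ltW bump_floor_gt0) /=.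
have := xB k; rewrite /arg /factor k0; exact: bump_ge.
Qed.

Variables (A : R) (A1 : 1 <= A)
  (bump_bound : forall j z, (j <= 2)%N -> `|derive1n j bump z| <= A).

(** Both derivatives fall on the cut-off in the direction a, whence L^-2. *)
Lemma tensor_dir2_bound a x : a != i0 ->
  `|tensor factor (incr (dir a) a) x|
  <= expR (2 * x ord0 i0) * (A * (L^-1 * L^-1)).
Proof.
move=> a0; rewrite tensor_split normrM.
have -> : incr (dir a) a i0 = 0%N by rewrite /incr /dir /incr eq_sym (negbTE a0).
apply: ler_pM => //; first by rewrite /= ger0_norm ?radial_ge0// radial_le.
rewrite /transverse (bigD1 a)//= normrM -[leRHS]mulr1; apply: ler_pM => //.
  rewrite (_ : incr (dir a) a a = 2%N); last by rewrite /dir /incr eqxx.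
  rewrite /factor (negbTE a0) derive1n_affine; last exact: smooth1_bump.
  rewrite normrM expr2 ger0_norm; last by rewrite mulr_ge0// invr_ge0 ltW.
  by rewrite mulrC ler_wpM2r ?bump_bound// mulr_ge0// invr_ge0 ltW.
rewrite normr_prod; apply: prodr_le1 => k /andP[/negbTE k0 /negbTE ka].
by rewrite normr_ge0 /dir /incr ka /factor k0 /= ger0_norm ?bump_ge0// bump_le1.
Qed.

Lemma weight_inv_le a s : 0 <= s -> a != i0 -> (weight a s)^-1 <= expR (2 * s).
Proof.
move=> s0 a0; rewrite /weight (negbTE a0).
have e2 : expR (2 * s) = expR s * expR s by rewrite -expRD; congr expR; ring.
case: ifP => _; last by rewrite invr1 -(expR0 R) ler_expR mulr_ge0.
have c0 := ltW (cosh_gt0 s); have c1 := cosh_le_expR s0.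
by rewrite invrK e2; apply: ler_pM.
Qed.

(** The weights and the radial factor grow exponentially on the support, up to
    exp(16 N) in total; L has to dominate this. *)
Hypothesis LN : (m%:R * expR (16 * N)) * N <= L.

Lemma transverse_small a x : a != i0 -> tbox 1 x ->
  `|(weight a (x ord0 i0))^-1 * partial a (partial a test) x| <= A / (N * m%:R).
Proof.
have A0 : 0 <= A := le_trans ler01 A1.
move=> a0 /tboxP /(_ i0); rewrite /arg eqxx; set s := x ord0 i0 => xs.
have [s1 s2] : 2 * N <= s /\ s <= 4 * N.
  have : `|s - 3 * N| <= N.
    have -> : s - 3 * N = (N^-1 * s + - 3) * N by field; rewrite gt_eqF.
    by rewrite normrM (gtr0_norm N0) ler_piMl ?(ltW N0).
  by rewrite ler_norml => /andP[? ?]; split; lra.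
have s0 : 0 <= s by lra.
rewrite partial2_test normrM [X in X * _]ger0_norm ?invr_ge0 ?(ltW (weight_gt0 _ _))//.
apply: (@le_trans _ _ (expR (2 * s) * (expR (2 * s) * (A * (L^-1 * L^-1))))).
  apply: ler_pM => //; first by rewrite invr_ge0 ltW// weight_gt0.
    exact: weight_inv_le.
  exact: tensor_dir2_bound.
rewrite mulrA -expRD.
apply: (@le_trans _ _ (expR (16 * N) * (A * (L^-1 * L^-1)))).
  apply: ler_wpM2r; last by rewrite ler_expR; lra.
  by rewrite !mulr_ge0 ?invr_ge0 ?(ltW L0).
have m0 : 0 < m%:R :> R by rewrite ltr0n.
have Nm : 0 < N * m%:R by rewrite mulr_gt0.
rewrite ler_pdivlMr//.
have -> : expR (16 * N) * (A * (L^-1 * L^-1)) * (N * m%:R)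
    = A * ((m%:R * expR (16 * N)) * N / (L * L)) by field; rewrite gt_eqF.
rewrite ler_piMr//.
by rewrite ler_pdivrMr ?mulr_gt0// mul1r; apply: le_trans LN _; rewrite ler_peMl ?(ltW L0).
Qed.

(** A derivative that falls on the bump costs 1/N; without any such derivative
    there remains a multiple of 1 - tanh, which is small because exp(2 s) is
    nearly harmonic. *)
Lemma radial_small s : 2 * N <= s ->
  `|(cosh s * cosh s)^-1 * (derive1n 2 radial s - 2 * tanh s * derive1n 1 radial s)|
  <= 36 * A / N.
Proof.
have A1' := A1; have N2' := N2.
move=> sN; rewrite radial1 radial2 addr0.
have := bump_bound (N^-1 * s + - 3) (isT : (1 <= 2)%N).
have := bump_bound (N^-1 * s + - 3) (isT : (2 <= 2)%N).
have : 0 <= bd 0 s <= 1 by rewrite bump_ge0 bump_le1.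
set b0 := bd 0 s; set b1 := bd 1 s; set b2 := bd 2 s => /andP[b00 b01] hb2 hb1.
have t1 := tanh_le1 s; have tN := tanh_close N0 sN.
have N1 : N^-1 <= 1 by rewrite invf_le1//; lra.
have N10 : 0 < N^-1 by rewrite invr_gt0.
have c0 := cosh_gt0 s.
set q := N^-1 in tN N1 N10 *; set t := tanh s in t1 tN *.
have -> : (cosh s * cosh s)^-1 * (expR (2 * s) * (4 * b0 + 4 * q * b1 + q * q * b2)
    - 2 * t * (expR (2 * s) * (2 * b0 + q * b1)))
  = (expR (2 * s) / (cosh s * cosh s))
    * (4 * b0 * (1 - t) + (4 - 2 * t) * q * b1 + q * q * b2).
  by ring.
have e4 : expR (2 * s) / (cosh s * cosh s) <= 4.
  have cc : 0 < cosh s * cosh s by exact: mulr_gt0.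
  rewrite ler_pdivrMr//.
  have -> : expR (2 * s) = expR s * expR s by rewrite -expRD; congr expR; ring.
  have -> : 4 * (cosh s * cosh s) = (2 * cosh s) * (2 * cosh s) by ring.
  by apply: ler_pM; rewrite ?expR_ge0 ?expR_le_cosh.
have -> : 36 * A * q = 4 * (9 * A * q) by ring.
rewrite normrM; apply: ler_pM => //.
  by rewrite ger0_norm// divr_ge0 ?expR_ge0 ?mulr_ge0 ?(ltW c0).
have t0 : 0 <= t.
  by have : q <= 2^-1; [rewrite lef_pV2 ?posrE|lra].
apply: (le_trans (ler_normD _ _)); apply: (@le_trans _ _ ((4 * q + 4 * A * q) + A * q)); last first.
  have : q <= A * q by rewrite ler_peMl// ltW.
  lra.
apply: lerD; last first.
  rewrite normrM mulrC; apply: ler_pM => //.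
  by rewrite ger0_norm ?mulr_ge0 ?(ltW N10)// ler_piMl ?(ltW N10).
apply: (le_trans (ler_normD _ _)); apply: lerD.
  have t1' : 0 <= 1 - t by rewrite subr_ge0.
  have b4 : 0 <= 4 * b0 by rewrite mulr_ge0.
  rewrite ger0_norm; last by rewrite mulr_ge0.
  rewrite -mulrA ler_pM2l//; apply: le_trans tN.
  by rewrite ler_piMl//; lra.
rewrite normrM [X in X * _]ger0_norm; last by rewrite mulr_ge0 ?(ltW N10)//; lra.
rewrite [leRHS](_ : _ = 4 * q * A); last by ring.
apply: ler_pM => //; first by rewrite mulr_ge0 ?(ltW N10)//; lra.
by rewrite ler_wpM2r ?(ltW N10)//; lra.
Qed.

Lemma tbox_radial t x : tbox t x ->
  (3 - t) * N <= x ord0 i0 <= (3 + t) * N.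
Proof.
move=> /tboxP /(_ i0); rewrite /arg eqxx => xs.
have : `|x ord0 i0 - 3 * N| <= t * N.
  have -> : x ord0 i0 - 3 * N = (N^-1 * x ord0 i0 + - 3) * N.
    by field; rewrite gt_eqF.
  by rewrite normrM (gtr0_norm N0) ler_wpM2r ?(ltW N0).
by rewrite ler_norml => /andP[? ?]; apply/andP; split; lra.
Qed.

Lemma laplacian_out x : ~ tbox 1 x ->
  \sum_a (weight a (x ord0 i0))^-1 * partial a (partial a test) x
    - 2 * tanh (x ord0 i0) / weight i0 (x ord0 i0) * partial i0 test x = 0.
Proof.
move=> xB; rewrite big1 => [|a _]; last by rewrite partial2_test tensor_out// mulr0.
by rewrite partial_test tensor_out// mulr0 subrr.
Qed.

(** The direction x_0 gives 36 A / N, the other directions at most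
    A / (N m) each. *)
Lemma laplacian_small x :
  `|\sum_a (weight a (x ord0 i0))^-1 * partial a (partial a test) x
    - 2 * tanh (x ord0 i0) / weight i0 (x ord0 i0) * partial i0 test x|
  <= 37 * A / N.
Proof.
have A0 : 0 <= A := le_trans ler01 A1.
have [xB|xB] := pselect (tbox 1 x); last first.
  rewrite laplacian_out// normr0.
  by rewrite mulr_ge0 ?invr_ge0 ?(ltW N0)// mulr_ge0.
have /andP[sN _] := tbox_radial xB; set s := x ord0 i0 in sN *.
have {}sN : 2 * N <= s by lra.
rewrite (bigD1 i0)//= addrAC.
have -> : 37 * A / N = 36 * A / N + A / N by ring.
apply: le_trans (ler_normD _ _) _; apply: lerD.
  rewrite partial2_test partial_test !tensor_split transverse_dir0 transverse_dir00 -/s.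
  rewrite (_ : incr (dir i0) i0 i0 = 2%N) // (_ : dir i0 i0 = 1%N)//.
  rewrite (_ : weight i0 s = cosh s * cosh s)//.
  set P := transverse _ _; have /andP[P0 P1] : 0 <= P <= 1 := transverse_itv x.
  rewrite [X in `|X|](_ : _ = (cosh s * cosh s)^-1
     * (derive1n 2 radial s - 2 * tanh s * derive1n 1 radial s) * P); last by ring.
  rewrite normrM (ger0_norm P0) -[leRHS]mulr1; apply: ler_pM => //.
  exact: radial_small.
apply: le_trans (ler_norm_sum _ _ _) _.
have m0 : 0 < m%:R :> R by rewrite ltr0n.
have c0 : 0 <= A / (N * m%:R) by rewrite divr_ge0// mulr_ge0 ?(ltW N0)// ltW.
apply: (@le_trans _ _ (\sum_(a : 'I_m) A / (N * m%:R))).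
  rewrite big_mkcond /=; apply: ler_sum => a _; case: ifP => // a0.
  exact: transverse_small.
rewrite sumr_const card_ord -[_ *+ _]mulr_natr invfM -!mulrA mulVf ?mulr1//.
Qed.

Hypothesis AN : A <= N * (bump_floor ^+ m / 4).

(** The main term is - tanh cosh^-2 d_0 f, where d_0 f is the derivative of
    exp(2 x_0) up to the cut-off. The factor 1/4 comes from 1/2 <= tanh and
    from giving up half of the main term for the second derivative along x_1. *)
Lemma hessian_large x : tbox 2^-1 x ->
  bump_floor ^+ m / 4 <=
  `|(weight i1 (x ord0 i0))^-1 * partial i1 (partial i1 test) x
    - tanh (x ord0 i0) / weight i0 (x ord0 i0) * partial i0 test x|.
Proof.
have A0 : 0 <= A := le_trans ler01 A1.
have N2' := N2; have N0' := N0.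
move=> xB; have PB := transverse_ge xB.
have b1 := bump_floor_gt0 (R := R).
have b2 : (bump_floor : R) <= 1 by rewrite /bump_floor expR_le1; lra.
have ANc := AN; set c := bump_floor ^+ m / 4 in ANc *.
have cE : c = bump_floor * bump_floor ^+ n.+1 / 4 by rewrite /c exprS.
have c0 : 0 < c by rewrite /c divr_gt0// exprn_gt0.
have AN' : A / N <= c by rewrite ler_pdivrMr// mulrC.
have cb : c <= bump_floor.
  rewrite cE; have : (bump_floor : R) ^+ n.+1 <= 1 by rewrite exprn_ile1// ltW.
  have : 0 <= (bump_floor : R) ^+ n.+1 by rewrite exprn_ge0// ltW.
  by move=> h0 h1; rewrite -mulrA ler_piMr ?(ltW b1)//; lra.
have xB1 : tbox 1 x.
  apply/tboxP => k; move/tboxP: xB => /(_ k) h; apply: (le_trans h).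
  by rewrite invf_le1// ler1n.
have small := transverse_small (isT : i1 != i0) xB1.
have /andP[sN sN'] := tbox_radial xB1; set s := x ord0 i0 in small sN sN' *.
have {}sN : 2 * N <= s by lra.
have s0 : 0 <= s by lra.
have sml : `|(weight i1 s)^-1 * partial i1 (partial i1 test) x| <= c.
  apply: le_trans small _; apply: le_trans AN'.
  rewrite invfM mulrA ler_piMr ?divr_ge0 ?(ltW N0)// invf_le1 ?ltr0n//.
  by rewrite ler1n.
rewrite distrC; apply: le_trans (lerB_dist _ _).
suff big : 2 * c <= `|tanh s / weight i0 s * partial i0 test x| by lra.
rewrite partial_test tensor_split transverse_dir0 -/s (_ : dir i0 i0 = 1%N)// radial1 addr0.
rewrite (_ : weight i0 s = cosh s * cosh s)//.
have := bump_bound (N^-1 * s + - 3) (isT : (1 <= 2)%N).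
have hb : bump_floor <= bd 0 s.
  by apply: bump_ge; move/tboxP: xB => /(_ i0); rewrite /arg eqxx.
set b := bd 0 s in hb *; set b' := bd 1 s => hb'.
set P := transverse _ _ in PB *.
have hN : - (A / N) <= N^-1 * b'.
  have : `|N^-1 * b'| <= A / N.
    rewrite normrM normfV (gtr0_norm N0') mulrC.
    by apply: ler_wpM2r => //; rewrite invr_ge0 ltW.
  by rewrite ler_norml => /andP[].
have hf : bump_floor <= 2 * b + N^-1 * b' by lra.
have th : 2^-1 <= tanh s.
  have := tanh_close N0 sN.
  have : N^-1 <= 2^-1 by rewrite lef_pV2 ?posrE.
  lra.
have e1 : 1 <= expR (2 * s) / (cosh s * cosh s).
  have cc : 0 < cosh s * cosh s by apply: mulr_gt0; exact: cosh_gt0.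
  rewrite ler_pdivlMr// mul1r.
  have -> : expR (2 * s) = expR s * expR s by rewrite -expRD; congr expR; ring.
  by apply: ler_pM; rewrite ?cosh_le_expR// ltW// cosh_gt0.
apply: le_trans (ler_norm _).
have -> : 2 * c = 2^-1 * 1 * (bump_floor * bump_floor ^+ n.+1).
  by rewrite cE; field.
have -> : tanh s / (cosh s * cosh s) * (expR (2 * s) * (2 * b + N^-1 * b') * P)
  = tanh s * (expR (2 * s) / (cosh s * cosh s)) * ((2 * b + N^-1 * b') * P) by ring.
have p0 : 0 <= (bump_floor : R) ^+ n.+1 by rewrite exprn_ge0// ltW.
have h0 : 0 <= 2^-1 :> R by rewrite invr_ge0.
have q1 : 2^-1 * 1 <= tanh s * (expR (2 * s) / (cosh s * cosh s)).
  exact: ler_pM.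
have q2 : bump_floor * bump_floor ^+ n.+1 <= (2 * b + N^-1 * b') * P.
  by apply: ler_pM => //; exact: ltW.
by apply: ler_pM => //; apply: mulr_ge0 => //; exact: ltW.
Qed.

Lemma test_bound x : `|test x| <= expR (8 * N).
Proof.
have N0' := N0; have [xB|xB] := pselect (tbox 1 x); last first.
  by rewrite test_out// normr0 expR_ge0.
have /andP[_ sN] := tbox_radial xB.
rewrite /test tensor_split normrM /= ger0_norm ?radial_ge0//.
have /andP[P0 P1] := transverse_itv x; rewrite (ger0_norm P0).
rewrite -[leRHS]mulr1; apply: ler_pM => //; first exact: radial_ge0.
by apply: le_trans (radial_le _) _; rewrite ler_expR; lra.
Qed.

Lemma compact_support_test : compact (closure [set x | test x != 0]).
Proof.
have cB : closed (tbox 1) by exact: closed_cbox.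
have kB : compact (tbox 1) by exact: compact_cbox.
apply: (subclosed_compact (@closed_closure _ _) kB).
rewrite [X in _ `<=` X](closure_id _).1//; apply: closureS => x /= x0.
by apply: contrapT => xB; move: x0; rewrite test_out// eqxx.
Qed.

End test_function.

(** * The counterexample *)

Section volume_of_warped.
Context {R : realType} {n : nat}.
Local Notation m := n.+2.
Variables (mu : R) (mu0 : 0 < mu).
Local Notation M := (@warped R n mu mu0).

Definition warped_volume : {measure set (borel M) -> \bar R} :=
  euclid_vol m (NngNum (sqrtr_ge0 (mu ^+ m))).

Lemma warped_volumeP : @riemannian_volume R m M warped_volume.
Proof.
move=> [] A mA _ row.
have -> : @coords R m M tt @` A = A by rewrite -[RHS]image_id.
under eq_integral do rewrite /= det_metric.
rewrite (@integral_cst _ _ _ (lebesgue_tuple m) _ _ (Num.sqrt (mu ^+ m))%:E)//.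
rewrite -[_ @^-1` _]setTI.
exact: (measurable_row_of measurableT mA).
Qed.

Lemma warped_volume_tbox (N L t : R) : 0 < N -> 0 < L -> 0 <= t ->
  warped_volume (tbox N L t)
  = (Num.sqrt (mu ^+ m) * ((2 * t) ^+ m * \prod_k @radius R n N L k))%:E.
Proof.
move=> N0 L0 t0.
have r0 (k : 'I_m) : 0 < radius N L k by rewrite /radius; case: ifP.
rewrite /warped_volume euclid_vol_cbox /=; last first.
  by move=> k; rewrite lerD2l ge0_cp// mulr_ge0// ltW.
congr (_ * _)%:E.
rewrite (eq_bigr (fun k => (2 * t) * radius N L k)); last by move=> k _; ring.
by rewrite big_split /= prodr_const card_ord.
Qed.

End volume_of_warped.

Theorem theorem1p1 (R : realType) (p : \bar R) (m : nat) (C1 C2 : R)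
    (hp : (1 <= p)%E) (hm : (2 <= m)%N) (hC1 : 0 < C1) (hC2 : 0 < C2) :
  exists (M : riemannian_manifold R m)
         (vol : {measure set (borel M) -> \bar R}),
    [/\ riemannian_volume vol, open_manifold M &
     exists f : M -> R,
       [/\ smooth f, compactly_supported f,
        (forall r : R, p = r%:E ->
           (C1%:E * 'N[vol]_p[EFin \o laplacian f] `^ r
            + C2%:E * 'N[vol]_p[EFin \o f] `^ r
            < 'N[vol]_p[EFin \o hessian_norm f] `^ r)%E) &
        (p = +oo%E ->
           (C1%:E * 'N[vol]_p[EFin \o laplacian f]
            + C2%:E * 'N[vol]_p[EFin \o f]
            < 'N[vol]_p[EFin \o hessian_norm f])%E)]].
Proof.
case: m hm => [|[|n]]// _.
have [A A1 HA] := @bump_derive_bound R.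
have A0 : 0 < A := lt_le_trans ltr01 A1.
pose c : R := bump_floor ^+ n.+2 / 4.
have c0 : 0 < c by rewrite divr_gt0// exprn_gt0// bump_floor_gt0.
(* the ratio of the volumes of the boxes with t = 1 and t = 1/2 *)
pose Q : R := 2 ^+ n.+2.
have Q1 : 1 <= Q by rewrite exprn_ege1// ler1n.
have CQ0 : 0 < (C1 + C2) * Q.
  by rewrite mulr_gt0 ?addr_gt0// (lt_le_trans ltr01).
pose delta := (1 + (C1 + C2) * Q)^-1.
have d0 : 0 < delta by rewrite invr_gt0 addr_gt0.
have d1 : delta <= 1 by rewrite invf_le1 ?addr_gt0// lerDl ltW.
have small : (C1 + C2) * Q * delta < 1.
  by rewrite ltr_pdivrMr ?addr_gt0// mul1r ltrDr.
(* N makes the Laplacian small compared with the Hessian, then L makes the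
   cut-offs in the other coordinates harmless, and mu scales f down. *)
pose N := 2 + 37 * A / (delta * c).
have N2 : 2 <= N by rewrite lerDl divr_ge0// mulr_ge0// ltW.
have N0 : 0 < N := lt_le_trans (ltr0Sn R 1) N2.
have AN : 37 * A <= N * (delta * c).
  have dc0 : 0 < delta * c by rewrite mulr_gt0.
  have -> : N * (delta * c) = 2 * (delta * c) + 37 * A.
    by rewrite /N; field; rewrite !gt_eqF.
  by rewrite lerDr mulr_ge0// ltW.
have ANc : A <= N * c.
  apply: (@le_trans _ _ (37 * A)); first by rewrite ler_peMl ?(ltW A0)// ler1n.
  by apply: le_trans AN _; rewrite ler_pM2l// ler_piMl// ltW.
pose L := 1 + (n.+2%:R * expR (16 * N)) * N.
have LN0 : 0 <= (n.+2%:R * expR (16 * N)) * N.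
  by rewrite !mulr_ge0 ?expR_ge0 ?(ltW N0).
have L1 : 1 <= L by rewrite lerDl.
have L0 : 0 < L := lt_le_trans ltr01 L1.
have LN : (n.+2%:R * expR (16 * N)) * N <= L by rewrite lerDr.
pose mu := delta * c / expR (8 * N).
have mu0 : 0 < mu by apply: divr_gt0; [exact: mulr_gt0|exact: expR_gt0].
pose M := @warped R n mu mu0.
exists M, (warped_volume mu0); split.
- exact: warped_volumeP.
- exact: warped_open.
pose f : M -> R := @test R n N L.
exists f.
have sf := @smooth1_factor R n N L.
have vol t := @warped_volume_tbox R n mu mu0 N L t N0 L0.
pose V := Num.sqrt (mu ^+ n.+2) * \prod_k @radius R n N L k.
have V0 : 0 < V.
  rewrite mulr_gt0 ?sqrtr_gt0 ?exprn_gt0// prodr_gt0// => k _.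
  by rewrite /radius; case: ifP.
have volB : warped_volume mu0 (@tbox R n N L 2^-1) = V%:E.
  have h0 : 0 <= 2^-1 :> R by rewrite invr_ge0.
  by apply: (etrans (vol 2^-1 h0)); rewrite divff// expr1n mul1r.
have volB' : warped_volume mu0 (@tbox R n N L 1) = (Q * V)%:E.
  by apply: (etrans (vol 1 ler01)); rewrite mulr1 /V /Q; congr _%:E; ring.
(* the lower bound for the Hessian in the rescaled metric *)
pose H := c / mu.
have H0 : 0 < H by rewrite divr_gt0.
have muH : delta * H = mu^-1 * (delta * c) by rewrite /H; ring.
have hB (x : M) : tbox N L 2^-1 x -> H <= hessian_norm f x.
  move=> xB; apply: le_trans (hessian_norm_ge f x).
  rewrite /H mulrC ler_pM2l ?invr_gt0//.
  exact: (hessian_large N2 L1 A1 HA LN ANc xB).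
have f0 (x : M) : ~ tbox N L 1 x -> f x = 0 by exact: test_out.
have fK (x : M) : `|f x| <= delta * H.
  apply: le_trans (test_bound N2 L1 x) _.
  rewrite muH /mu invf_div mulrAC -mulrA divff ?mulr1//.
  by rewrite gt_eqF// mulr_gt0.
have g0 (x : M) : ~ tbox N L 1 x -> laplacian f x = 0.
  by move=> xB; rewrite laplacianE (laplacian_out N2 L1 xB) mulr0.
have gK (x : M) : `|laplacian f x| <= delta * H.
  rewrite laplacianE normrM gtr0_norm ?invr_gt0// muH ler_pM2l ?invr_gt0//.
  apply: le_trans (laplacian_small N2 L1 A1 HA LN x) _.
  by rewrite ler_pdivrMr// [leRHS]mulrC.
have d01 : 0 < delta <= 1 by rewrite d0.
have [Hr Hoo] := Lnorm_estimate_fails (measurable_cbox _ _) (measurable_cbox _ _)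
  H0 V0 volB volB' hC1 hC2 d01 Q1 erefl small hB fK f0 gK g0 hp.
split => //.
- by move=> [] ; rewrite chart_imageT; exact: smooth_tensor.
- exact: compact_support_test.
Qed.
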